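(* In the splitting scheme there is a constant $c$, independent of $n$ and $\tau$, such that for every $n$, $\mathcal K(\sigma^{n+1/2})\le\mathcal K(\sigma^n)+c\tau$.
   Context: Setting. $\Omega\subset\mathbb R$ is a bounded open interval and $T>0$. $BV(\Omega)$ is the space of functions $f:\bar\Omega\to\mathbb R$ with finite total variation $|f|_{BV}:=\sup_P\sum_{i=1}^{|P|-1}|f(x_{i+1})-f(x_i)|$, the supremum over finite partitions $P=\{x_1<\dots<x_{|P|}\}\subset\Omega$. A function $\chi:[0,\infty)\to\mathbb R$ is an internal energy density: $\chi\in C^0([0,\infty))\cap C^2((0,\infty))$, $\chi''>0$ on $(0,\infty)$, $\lim_{h\downarrow0}\chi'(h)=0$, and the integrals $\kappa(x):=\int_1^x\frac{\chi''(s)}{s}\,ds$ and $K(\sigma):=\int_0^\sigma\kappa(x)\,dx$ exist. Put $\mathcal K(\sigma):=\int_\Omega K(\sigma)\,dx$ and $\mathcal E(\rho,\eta):=\int_\Omega\chi(\rho+\eta)\,dx$. The functions $F_1,F_2,G_1,G_2:[0,\infty)^2\to\mathbb R$ are bounded and Lipschitz, with $G_1(0,\eta)\ge0$ for all $\eta\ge0$ and $G_2(\rho,0)\ge0$ for all $\rho\ge0$. For $\sigma\ge0$, $r\in[0,1]$ set $\tilde F_i(\sigma,r)=F_i(r\sigma,(1-r)\sigma)$, $\tilde G_i(\sigma,r)=G_i(r\sigma,(1-r)\sigma)$, $A_1=\tilde F_1+\tilde G_2$, $A_2=\tilde G_1+\tilde F_2$, $A_3=\tilde F_1-\tilde F_2$,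 $\Sigma(\sigma,r)=\sigma(rA_1+(1-r)A_2)$, $R(\sigma,r)=r(1-r)A_3+(1-r)^2\tilde G_1-r^2\tilde G_2$. Initial data: $\rho_0,\eta_0\in BV(\Omega)\cap L^\infty(\Omega)$ nonnegative, $\sigma_0=\rho_0+\eta_0$, and $r_0\in BV(\Omega)$ with $0\le r_0\le1$ and $r_0=\rho_0/\sigma_0$ on $\{\sigma_0>0\}$. For $m>0$, $\mathcal P^m(\Omega)$ is the set of nonnegative Borel measures on $\Omega$ of total mass $m$; $W_p$ ($p=1,2$) is the $p$-Wasserstein distance between measures of equal mass, $W_p^p(\mu,\nu)=\inf_\gamma\int|x-y|^p\,d\gamma$ over couplings $\gamma$ of $\mu,\nu$. Splitting scheme. Fix $\tau\in(0,1)$ and $N\in\mathbb N$ with $N\tau=T$; set $r^0=r_0$, $\sigma^0=\sigma_0$. For $n=0,\dots,N-1$: (Reaction step) for each $x\in\Omega$ solve $\dot\sigma=\Sigma(\sigma,r)$, $\dot r=R(\sigma,r)$ on $[0,\tau]$ with $\sigma(0)=\sigma^n(x)$, $r(0)=r^n(x)$, and set $\sigma^{n+1/2}(x)=\sigma(\tau)$, $r^{n+1/2}(x)=r(\tau)$, $\rho^{n+1/2}=r^{n+1/2}\sigma^{n+1/2}$, $\eta^{n+1/2}=(1-r^{n+1/2})\sigma^{n+1/2}$, $U^{n+1/2}=(\rho^{n+1/2},\eta^{n+1/2})$. (Diffusion step) with $m_1=\int_\Omega\rho^{n+1/2}$, $m_2=\int_\Omega\eta^{n+1/2}$, let $U^{n+1}=(\rho^{n+1},\eta^{n+1})$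 be a minimiser over $(\rho,\eta)\in\mathcal P^{m_1}(\Omega)\times\mathcal P^{m_2}(\Omega)$ of $\frac1{2\tau}\big[W_2^2(\rho,\rho^{n+1/2})+W_2^2(\eta,\eta^{n+1/2})\big]+\mathcal E(\rho,\eta)$; set $\sigma^{n+1}=\rho^{n+1}+\eta^{n+1}$ and $r^{n+1}=r^{n+1/2}\circ\mathcal T$, where $\mathcal T$ is the nondecreasing optimal transport map pushing $\sigma^{n+1}$ forward to $\sigma^{n+1/2}$. Also $\rho^n=r^n\sigma^n$, $\eta^n=(1-r^n)\sigma^n$, $U^n=(\rho^n,\eta^n)$. Piecewise constant interpolation: for $t\in[n\tau,(n+1)\tau)$, $r_\tau(t)=r^n$, $\sigma_\tau(t)=\sigma^n$, $\rho_\tau(t)=r^n\sigma^n$, $\eta_\tau(t)=(1-r^n)\sigma^n$, $U_\tau=(\rho_\tau,\eta_\tau)$. *)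

(* Defs.v *)
From HB Require Import structures.
From mathcomp Require Import all_boot all_order all_algebra.
From mathcomp Require Import all_classical all_reals all_analysis.

Set Implicit Arguments.
Unset Strict Implicit.
Unset Printing Implicit Defensive.

Import Order.TTheory GRing.Theory Num.Theory.
Import numFieldNormedType.Exports.
Local Open Scope classical_set_scope.
Local Open Scope ring_scope.

Section SplittingDefs.
Context {R : realType}.
Local Notation mu := (@lebesgue_measure R).

Definition BV (a b : R) (f : R -> R) : Prop :=
  exists M : R, forall s : seq R, sorted <%R s -> all (fun x => (a < x) && (x < b)) s ->
    \sum_(i < (size s).-1) `|f (nth 0 s i.+1) - f (nth 0 s i)| <= M.

(** L^infinity (pointwise bound; BV functions are pointwise bounded anyway). *)
Definition Linfty (a b : R) (f : R -> R) : Prop :=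
  exists M : R, forall x, a < x < b -> `|f x| <= M.

Definition d2 (chi : R -> R) : R -> R := derive1 (derive1 chi).

Definition kappa (chi : R -> R) (x : R) : R :=
  if 1 <= x then Rintegral mu `[1, x] (fun s => d2 chi s / s)
  else - Rintegral mu `[x, 1] (fun s => d2 chi s / s).

Definition Kfun (chi : R -> R) (sig : R) : R :=
  Rintegral mu `[0, sig] (kappa chi).

Definition internal_energy_density (chi : R -> R) : Prop :=
  {within `[0, +oo[, continuous chi} /\
  (forall x, 0 < x -> derivable chi x 1) /\
  (forall x, 0 < x -> derivable (derive1 chi) x 1) /\
  {in `]0, +oo[, continuous (d2 chi)} /\
  (forall x, 0 < x -> 0 < d2 chi x) /\
  (derive1 chi x @[x --> 0^'+] --> 0) /\
  (* the integrals kappa(x) exist (automatic for x > 0 since chi'' is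
     continuous on ]0,oo[) and K(sigma) = int_0^sigma kappa exists *)
  (forall x, 0 < x -> mu.-integrable `[Order.min x 1, Order.max x 1]
                         (fun s => (d2 chi s / s)%:E)) /\
  (forall sig, 0 <= sig -> mu.-integrable `[0, sig] (fun x => (kappa chi x)%:E)).

Definition calK (a b : R) (chi : R -> R) (sig : R -> R) : \bar R :=
  (\int[mu]_(x in `]a, b[) (Kfun chi (sig x))%:E)%E.

Definition calE (a b : R) (chi : R -> R) (f g : R -> R) : \bar R :=
  (\int[mu]_(x in `]a, b[) (chi (f x + g x))%:E)%E.

Definition bdd_lip (F : R -> R -> R) : Prop :=
  exists M L : R,
    (forall x y, 0 <= x -> 0 <= y -> `|F x y| <= M) /\
    (forall x y x' y', 0 <= x -> 0 <= y -> 0 <= x' -> 0 <= y' ->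
       `|F x y - F x' y'| <= L * (`|x - x'| + `|y - y'|)).

Definition tildeF (F : R -> R -> R) (sig r : R) : R := F (r * sig) ((1 - r) * sig).

Definition SigmaF (F1 F2 G1 G2 : R -> R -> R) (sig r : R) : R :=
  let A1 := tildeF F1 sig r + tildeF G2 sig r in
  let A2 := tildeF G1 sig r + tildeF F2 sig r in
  sig * (r * A1 + (1 - r) * A2).

Definition RF (F1 F2 G1 G2 : R -> R -> R) (sig r : R) : R :=
  let A3 := tildeF F1 sig r - tildeF F2 sig r in
  r * (1 - r) * A3 + (1 - r) ^+ 2 * tildeF G1 sig r - r ^+ 2 * tildeF G2 sig r.

Definition reaction_flow (Sig Rr : R -> R -> R) (tau s0 r0 s1 r1 : R) : Prop :=
  exists s q : R -> R,
    s 0 = s0 /\ q 0 = r0 /\ s tau = s1 /\ q tau = r1 /\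
    {within `[0, tau], continuous s} /\ {within `[0, tau], continuous q} /\
    (forall t, 0 <= t <= tau -> 0 <= s t /\ 0 <= q t <= 1) /\
    (forall t, 0 < t < tau ->
       derivable s t 1 /\ derive1 s t = Sig (s t) (q t) /\
       derivable q t 1 /\ derive1 q t = Rr (s t) (q t)).

Definition coupling (a b : R) (f g : R -> R)
    (gam : {measure set (R * R) -> \bar R}) : Prop :=
  (forall A : set R, measurable A ->
     gam (A `*` setT) = (\int[mu]_(x in A `&` `]a, b[) (f x)%:E)%E) /\
  (forall B : set R, measurable B ->
     gam (setT `*` B) = (\int[mu]_(x in B `&` `]a, b[) (g x)%:E)%E).

Definition W2sq (a b : R) (f g : R -> R) : \bar R :=
  ereal_inf [set (\int[gam]_z ((z.1 - z.2) ^+ 2)%:E)%E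
            | gam in [set gam | coupling a b f g gam]].

Definition admissible (a b : R) (m : \bar R) (f : R -> R) : Prop :=
  (forall x, a < x < b -> 0 <= f x) /\
  mu.-integrable `]a, b[ (fun x => (f x)%:E) /\
  (\int[mu]_(x in `]a, b[) (f x)%:E)%E = m.

Definition mass (a b : R) (f : R -> R) : \bar R := (\int[mu]_(x in `]a, b[) (f x)%:E)%E.

Definition jko_functional (a b : R) (chi : R -> R) (tau : R) (rh eh f g : R -> R) : \bar R :=
  (((2 * tau)^-1)%:E * (W2sq a b f rh + W2sq a b g eh) + calE a b chi f g)%E.

(** (rho, eta) minimises the JKO functional over P^{m1} x P^{m2}
    (measures that are not absolutely continuous have infinite energy,
    so competitors are densities). *)
Definition jko_minimizer (a b : R) (chi : R -> R) (tau : R) (rh eh rho eta : R -> R) : Prop :=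
  (forall x, a <= x <= b -> 0 <= rho x /\ 0 <= eta x) /\
  admissible a b (mass a b rh) rho /\ admissible a b (mass a b eh) eta /\
  (forall f g, admissible a b (mass a b rh) f -> admissible a b (mass a b eh) g ->
     (jko_functional a b chi tau rh eh rho eta <= jko_functional a b chi tau rh eh f g)%E).

Definition monotone_ot_map (a b : R) (Tm f g : R -> R) : Prop :=
  (forall x, a <= x <= b -> a <= Tm x <= b) /\
  (forall x y, a <= x -> x <= y -> y <= b -> Tm x <= Tm y) /\
  measurable_fun `]a, b[ Tm /\
  (forall B : set R, measurable B ->
     (\int[mu]_(x in `]a, b[ `&` Tm @^-1` B) (f x)%:E)%E =
     (\int[mu]_(x in `]a, b[ `&` B) (g x)%:E)%E) /\
  (\int[mu]_(x in `]a, b[) (((x - Tm x) ^+ 2) * f x)%:E)%E = W2sq a b f g.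

Definition initial_data (a b : R) (rho0 eta0 r0 : R -> R) : Prop :=
  (forall x, a <= x <= b -> 0 <= rho0 x /\ 0 <= eta0 x) /\
  BV a b rho0 /\ BV a b eta0 /\ Linfty a b rho0 /\ Linfty a b eta0 /\
  BV a b r0 /\ (forall x, a <= x <= b -> 0 <= r0 x <= 1) /\
  (forall x, a <= x <= b -> 0 < rho0 x + eta0 x -> r0 x = rho0 x / (rho0 x + eta0 x)).

(** The splitting scheme, steps n = 0, ..., N-1.
    sig n = sigma^n, r n = r^n, sigh n = sigma^{n+1/2}, rh n = r^{n+1/2},
    rho (n+1), eta (n+1) = minimiser U^{n+1}, Tm n = transport map of step n. *)
Definition splitting_scheme (a b : R) (chi : R -> R) (F1 F2 G1 G2 : R -> R -> R)
    (rho0 eta0 r0 : R -> R) (tau : R) (N : nat)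
    (sig r sigh rh rho eta Tm : nat -> R -> R) : Prop :=
  (forall x, a <= x <= b -> sig 0%N x = rho0 x + eta0 x /\ r 0%N x = r0 x) /\
  forall n : nat, (n < N)%N ->
    (forall x, a <= x <= b ->
       reaction_flow (SigmaF F1 F2 G1 G2) (RF F1 F2 G1 G2) tau
         (sig n x) (r n x) (sigh n x) (rh n x)) /\
    jko_minimizer a b chi tau (fun x => rh n x * sigh n x)
      (fun x => (1 - rh n x) * sigh n x) (rho n.+1) (eta n.+1) /\
    (forall x, a <= x <= b -> sig n.+1 x = rho n.+1 x + eta n.+1 x) /\
    monotone_ot_map a b (Tm n) (sig n.+1) (sigh n) /\
    (forall x, a <= x <= b -> r n.+1 x = rh n (Tm n x)).

End SplittingDefs.

(* Main.v *)
Require Import Defs.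
From HB Require Import structures.
From mathcomp Require Import all_boot all_order all_algebra.
From mathcomp Require Import all_classical all_reals all_analysis.
From mathcomp Require Import measurable_realfun.
From mathcomp Require Import ring lra.
Set Implicit Arguments.
Unset Strict Implicit.
Unset Printing Implicit Defensive.
Import Order.TTheory GRing.Theory Num.Theory.
Import numFieldNormedType.Exports.
Local Open Scope classical_set_scope.
Local Open Scope ring_scope.

(** A convexity estimate K(y) - K(x) <= kappa(y) (y - x), together with the bound
    |y - x| <= O(tau) y for one reaction step from x to y, reduces the claim to an
    upper bound for y |kappa(y)|, hence to a bound for sigma^n in L^infinity which
    is uniform in n and tau.  The reaction step multiplies such a bound by at most
    exp(C tau), and the diffusion step does not increase it.  For the latter, let
    sigma^{n+1/2} <= M and suppose that the minimiser has density sigma > M on a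
    non-null set E.  Take almost optimal plans for both species and send a fraction
    e of the mass found in E back to where the plans pair it: the transport cost
    does not increase, and the energy changes, to first order in e, by the integral
    of chi'(sigma) (h - sigma 1_E), where h <= M is the density of the mass sent
    back.  Since chi' is increasing and h has the same mass as sigma 1_E, this is
    negative, which contradicts minimality.

    Measurability of the functions produced by the reaction step is never used: the
    library's integral of an arbitrary nonnegative function is a lower integral,
    which agrees with the integral of a measurable minorant. *)

Section LowerIntegral.
Local Open Scope ereal_scope.
Context d (T : measurableType d) (R : realType).
Variable mu : {measure set T -> \bar R}.
Import HBNNSimple.

Lemma ge0_le_lower_integral (D N : set T) (f g : T -> \bar R) :
  measurable N -> mu N = 0 ->
  (forall x, D x -> 0 <= f x) -> (forall x, D x -> 0 <= g x) ->
  (forall x, D x -> ~ N x -> f x <= g x) ->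
  \int[mu]_(x in D) f x <= \int[mu]_(x in D) g x.
Proof.
move=> mN muN f0 g0 fg; rewrite !ge0_integralE//.
apply: ge_ereal_sup => _ [h /= hf <-].
pose h' := proj_nnsfun h (measurableC mN).
apply: (@le_trans _ _ (sintegral mu h')); last first.
  apply: ereal_sup_ubound; exists h' => //= x.
  have g0' : 0 <= (g \_ D) x by apply: erestrict_ge0.
  rewrite mindicE; case: (boolP (x \in ~` N)) => [|_]; last by rewrite mulr0.
  rewrite inE mulr1 /= => Nx; apply: le_trans (hf x) _.
  by rewrite /patch; case: ifPn => // /[!inE] Dx; exact: fg.
rewrite -(integralT_nnsfun mu h) (@ge0_negligible_integral _ _ _ _ setT N)//; last 2 first.
  by apply/measurable_EFinP; exact: measurable_funP.
  by move=> x _; rewrite lee_fin.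
rewrite setTD integral_nnsfun; last exact: measurableC.
by rewrite (mrestrict h (measurableC mN)).
Qed.

Lemma measurable_minorant (D N : set T) (f : T -> R) :
  measurable D -> measurable N -> mu N = 0 ->
  (forall x, D x -> (0 <= f x)%R) -> \int[mu]_(x in D) (f x)%:E < +oo ->
  exists g : T -> R, [/\ measurable_fun setT g,
    (forall x, (0 <= g x)%R),
    (forall x, D x -> (g x <= f x)%R),
    (forall x, N x -> g x = 0%R) &
    forall B, measurable B ->
      \int[mu]_(x in B `&` D) (f x)%:E = \int[mu]_(x in B `&` D) (g x)%:E].
Proof.
move=> mD mN muN f0 foo.
have I0 : 0 <= \int[mu]_(x in D) (f x)%:E.
  by apply: integral_ge0 => x Dx; rewrite lee_fin f0.
have Ifin : \int[mu]_(x in D) (f x)%:E \is a fin_num by rewrite ge0_fin_numE.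
have f0E x : D x -> 0 <= (f x)%:E by move=> Dx; rewrite lee_fin f0.
have hP (n : nat) : exists h : {nnsfun T >-> R},
    (forall x, (h x)%:E <= ((EFin \o f) \_ D) x) /\
    \int[mu]_(x in D) (f x)%:E - (n.+1%:R^-1)%:E < sintegral mu h.
  have e0 : (0 < n.+1%:R^-1 :> R)%R by rewrite invr_gt0.
  move: Ifin; rewrite ge0_integralE// => Ifin.
  have [_ [h /= hf <-] lth] := ub_ereal_sup_adherent e0 Ifin.
  by exists h; split.
have [h hh] := choice hP.
pose G x := ereal_sup (range (fun n => (h n x)%:E)).
have mG : measurable_fun setT G.
  have -> : G = (fun x => esups (fun n => (h n x)%:E) 0%N).
    apply/funext => x; rewrite /G /esups /sdrop; congr ereal_sup.
    by apply/seteqP; split => _ [n _ <-]; exists n.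
  apply: measurable_fun_esups => // n; apply/measurable_EFinP; exact: measurable_funP.
have Gf x : G x <= ((EFin \o f) \_ D) x.
  by apply: ge_ereal_sup => _ [n _ <-]; exact: (hh n).1.
have hG n x : (h n x)%:E <= G x by apply: ereal_sup_ubound; exists n.
have G0 x : 0 <= G x by apply: le_trans (hG 0%N x); rewrite lee_fin.
have Gfin x : G x \is a fin_num.
  rewrite ge0_fin_numE//; apply: le_lt_trans (Gf x) _.
  by rewrite /patch; case: ifPn => _ /=; rewrite ltry.
pose g x := (fine (G x) * \1_(~` N) x)%R.
have mg : measurable_fun setT g.
  apply: measurable_funM.
    by apply: (@measurableT_comp _ _ _ _ _ _ fine) => //; exact: measurable_fine.
  by apply: measurable_indic; exact: measurableC.
have g0 x : (0 <= g x)%R by rewrite mulr_ge0// fine_ge0.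
have gf x : D x -> (g x <= f x)%R.
  move=> Dx; have := Gf x; rewrite /patch mem_set//= => Gfx.
  apply: (@le_trans _ _ (fine (G x))).
    by rewrite ler_piMr ?fine_ge0// indicE; case: (_ \in _).
  by rewrite -lee_fin fineK.
have mge B : measurable_fun B (fun x => (g x)%:E).
  by apply/measurable_EFinP; apply: measurable_funS mg.
have gD : \int[mu]_(x in D) (g x)%:E = \int[mu]_(x in D) (f x)%:E.
  apply/eqP; rewrite eq_le; apply/andP; split.
    apply: (@ge0_le_lower_integral D set0) => //.
      by move=> x _; rewrite lee_fin.
    by move=> x Dx _; rewrite lee_fin gf.
  apply/lee_subgt0Pr => e e0.
  have [n ne] : exists n, (n.+1%:R^-1 < e)%R.
    exact: filter_ex (near_infty_natSinv_lt (PosNum e0)).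
  apply: (@le_trans _ _ (sintegral mu (h n))).
    apply: le_trans (ltW (hh n).2); rewrite leeB// lee_fin; exact: ltW.
  rewrite -integralT_nnsfun [leRHS]integral_mkcond.
  apply: (@ge0_le_lower_integral setT N) => //.
  - by move=> x _; rewrite lee_fin.
  - by move=> x _; apply: erestrict_ge0 => // y _; rewrite lee_fin.
  - move=> x _ Nx; have := (hh n).1 x; rewrite /patch; case: ifPn => // _ hf.
    have := hG n x; rewrite -(fineK (Gfin x)) /g indicE mem_set ?mulr1//.
exists g; split => //.
  by move=> x Nx; rewrite /g indicE memNset ?mulr0//; apply.
move=> B mB; apply/eqP; rewrite eq_le; apply/andP; split; last first.
  apply: (@ge0_le_lower_integral (B `&` D) set0) => //.
  - by move=> x _; rewrite lee_fin.
  - by move=> x [_ /f0E].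
  - by move=> x [_ Dx] _; rewrite lee_fin gf.
have mBD : measurable (B `&` D) by exact: measurableI.
have mDB : measurable (D `\` B) by exact: measurableD.
have Esplit : (B `&` D) `|` (D `\` B) = D.
  by rewrite setIC setUIDK.
have disj : [disjoint B `&` D & D `\` B].
  apply/disj_setPS => x [[Bx _] [_ /(_ Bx)]] //.
rewrite ge0_integralE; last by move=> x [_ /f0E].
apply: ge_ereal_sup => _ [k /= kf <-].
pose g' := fun x => ((k x * \1_(B `&` D) x) + (g x * \1_(D `\` B) x))%R.
have mg' A : measurable_fun A (fun x => (g' x)%:E).
  apply/measurable_EFinP; apply: (@measurable_funS _ _ _ _ setT) => //.
  apply: measurable_funD; apply: measurable_funM => //.
have g'0 x : 0 <= (g' x)%:E by rewrite lee_fin addr_ge0// mulr_ge0.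
have g'1 x : (B `&` D) x -> g' x = k x.
  move=> BDx; rewrite /g' !indicE mem_set// mulr1 memNset ?mulr0 ?addr0//.
  by move=> [_]; case: BDx.
have g'2 x : (D `\` B) x -> g' x = g x.
  move=> DBx; rewrite /g' !indicE (mem_set DBx) mulr1.
  by rewrite memNset ?mulr0 ?add0r// => -[Bx _]; case: DBx.
have kE : sintegral mu k = \int[mu]_(x in B `&` D) (g' x)%:E.
  rewrite -integralT_nnsfun [RHS]integral_mkcond; apply: eq_integral => x _.
  rewrite /patch; case: ifPn => [/[!inE] /g'1->//|nx].
  have := kf x; rewrite /patch (negbTE nx) => kx; congr EFin.
  by apply/eqP; rewrite eq_le -lee_fin kx/=.
rewrite kE.
have H : \int[mu]_(x in D) (g' x)%:E <= \int[mu]_(x in D) (g x)%:E.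
  rewrite gD; apply: (@ge0_le_lower_integral D set0) => // x Dx _.
  have [Bx|Bx] := pselect (B x).
    by rewrite g'1//; have := kf x; rewrite /patch mem_set.
  by rewrite g'2// lee_fin gf.
move: H; rewrite -[in X in X <= _]Esplit -[in X in _ <= X]Esplit.
rewrite !ge0_integral_setU//; last by move=> x _; rewrite lee_fin.
rewrite (@eq_integral _ _ _ mu (D `\` B) (fun x => (g x)%:E)); last first.
  by move=> x /[!inE] /g'2 ->.
rewrite leeD2rE//.
have : \int[mu]_(x in D `\` B) (g x)%:E <= \int[mu]_(x in D) (g x)%:E.
  by apply: ge0_subset_integral => // x _; rewrite lee_fin.
rewrite gD => le1; rewrite ge0_fin_numE ?(le_lt_trans le1)//.
by apply: integral_ge0 => x _; rewrite lee_fin.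
Qed.

End LowerIntegral.

Section IntegralComparison.
Local Open Scope ereal_scope.
Context d (T : measurableType d) (R : realType).

Lemma integral_le_shift (mu : {measure set T -> \bar R}) (D N : set T)
    (u v : T -> R) (c : R) :
  measurable D -> mu D < +oo -> measurable N -> mu N = 0 ->
  mu.-integrable D (EFin \o u) ->
  (forall x, D x -> ~ N x -> (v x <= u x + c)%R) ->
  \int[mu]_(x in D) (v x)%:E <= \int[mu]_(x in D) (u x)%:E + c%:E * mu D.
Proof.
move=> mD Doo mN muN iu vu.
have ic : mu.-integrable D (EFin \o cst c).
  apply: measurable_bounded_integrable => //.
  exact: bounded_cst.
have -> : \int[mu]_(x in D) (u x)%:E + c%:E * mu D =
    \int[mu]_(x in D) (u x + c)%:E.
  rewrite -integral_cst// -integralD//.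
rewrite integralE [leRHS]integralE; apply: leeB.
- apply: (@ge0_le_lower_integral _ _ _ mu D N) => // x Dx Nx.
  by rewrite !funeposE ge_max !le_max lexx orbT andbT lee_fin vu.
- apply: (@ge0_le_lower_integral _ _ _ mu D N) => // x Dx Nx.
  by rewrite !funenegE ge_max !le_max lexx orbT andbT leeN2 lee_fin vu.
Qed.

Lemma bounded_density (mu : {sigma_finite_measure set T -> \bar R})
    (nu : {measure set T -> \bar R}) (D : set T) (p : T -> R) :
  measurable D -> measurable_fun D p -> (forall x, D x -> (0 <= p x)%R) ->
  \int[mu]_(x in D) (p x)%:E < +oo ->
  (forall B, measurable B -> nu B <= \int[mu]_(x in B `&` D) (p x)%:E) ->
  exists h : T -> R, [/\ measurable_fun D h,
    (forall x, D x -> (0 <= h x <= p x)%R) &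
    forall B, measurable B -> nu B = \int[mu]_(x in B `&` D) (h x)%:E].
Proof.
move=> mD mp p0 poo nup.
have p0E x : D x -> 0 <= (p x)%:E by move=> Dx; rewrite lee_fin p0.
have nuT : nu setT < +oo by apply: le_lt_trans (nup _ measurableT) _; rewrite setTI.
pose nu' : {finite_measure set T -> \bar R} := mfrestr measurableT nuT.
have nu'E A : nu' A = nu A by rewrite /nu' /= /mfrestr /mrestr setIT.
have dom : nu' `<< mu.
  apply/null_content_dominatesP => A mA muA; rewrite nu'E.
  apply/eqP; rewrite eq_le measure_ge0 andbT.
  apply: le_trans (nup A mA) _.
  rewrite null_set_integral//.
  - exact: measurableI.
  - by apply/measurable_EFinP; apply: measurable_funS mp => // x [].
  - apply/eqP; rewrite eq_le measure_ge0 andbT -muA le_measure ?inE//.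
    exact: measurableI.
pose f := Radon_Nikodym_SigmaFinite.f nu' mu.
have f0 x : 0 <= f x by exact: Radon_Nikodym_SigmaFinite.f_ge0.
have ffin x : f x \is a fin_num by exact: Radon_Nikodym_SigmaFinite.f_fin_num.
have fint : mu.-integrable setT f by exact: Radon_Nikodym_SigmaFinite.f_integrable.
have fE A : measurable A -> nu A = \int[mu]_(x in A) f x.
  by move=> mA; rewrite -nu'E; exact: Radon_Nikodym_SigmaFinite.f_integral.
have mf : measurable_fun setT f by exact: measurable_int fint.
pose h0 x := fine (f x).
have mh0 : measurable_fun setT h0.
  by apply: (@measurableT_comp _ _ _ _ _ _ fine) => //; exact: measurable_fine.
have h0E x : (h0 x)%:E = f x by rewrite fineK.
have mh0D : measurable_fun D h0 by exact: measurable_funS mh0.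
pose A := D `&` [set x | (p x < h0 x)%R].
have mA : measurable A by exact: measurable_fun_ltr.
have AD : A `<=` D by exact: subIsetl.
have [N [mN muN AN]] : ae_eq mu A f (fun x => (p x)%:E).
  apply: integral_ae_eq => //.
  - exact: integrableS fint.
  - by apply/measurable_EFinP; exact: measurable_funS mp.
  move=> E EA mE; apply/eqP; rewrite eq_le; apply/andP; split.
    rewrite -fE//; apply: le_trans (nup _ mE) _.
    by rewrite setIidl// => x /EA /AD.
  apply: ge0_le_integral => //.
  - by move=> x /EA/AD/p0E.
  - by apply/measurable_EFinP; apply: measurable_funS mp => // x /EA/AD.
  - exact: measurable_funS mf.
  - by move=> x /EA[_ /= /ltW]; rewrite -h0E lee_fin.
exists (fun x => Num.min (h0 x) (p x)); split.
- exact: measurable_minr.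
- by move=> x Dx; rewrite le_min p0// fine_ge0//= ge_min lexx orbT.
move=> B mB.
have mBD : measurable (B `&` D) by exact: measurableI.
have mBnD : measurable (B `\` D) by exact: measurableD.
rewrite fE// -[in LHS](setUIDK B D) ge0_integral_setU//; last 2 first.
  - by rewrite setUIDK; exact: measurable_funS mf.
  - by apply/disj_setPS => x [[_ Dx] [_ /(_ Dx)]].
have -> : \int[mu]_(x in B `\` D) f x = 0.
  apply/eqP; rewrite eq_le integral_ge0// andbT -fE//.
  apply: le_trans (nup _ mBnD) _.
  by rewrite setDE -setIA [_ `&` D]setIC setICr setI0 integral_set0.
rewrite adde0; apply: ae_eq_integral => //.
- exact: measurable_funS mf.
- apply/measurable_EFinP; apply: (@measurable_funS _ _ _ _ D) => //.
  exact: measurable_minr.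
exists N; split => // x /= /not_implyP[[Bx Dx] neq]; apply: AN => /= /(_ _).
have [hp|ph] := leP (h0 x) (p x).
  by exfalso; apply: neq; rewrite -h0E min_l.
move=> /(_ (conj Dx ph)) E.
by move: ph; rewrite -lte_fin h0E E ltxx.
Qed.

End IntegralComparison.

Section EnergyDensity.
Context {R : realType} {chi : R -> R} (ied : internal_energy_density chi).
Local Notation mu := (@lebesgue_measure R).
Local Notation chi' := (derive1 chi).
Local Notation kap := (kappa chi).
Local Notation K := (Kfun chi).

Let chi_continuous : {within `[0, +oo[, continuous chi}.
Proof. by case: ied. Qed.

Let chi_derivable (x : R) : 0 < x -> derivable chi x 1.
Proof. by case: ied => _ [+ _]; apply. Qed.

Let chi'_derivable (x : R) : 0 < x -> derivable chi' x 1.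
Proof. by case: ied => _ [_ [+ _]]; apply. Qed.

Let kappa_integrable (sig : R) : 0 <= sig -> mu.-integrable `[0, sig] (EFin \o kap).
Proof. by case: ied => _ [_ [_ [_ [_ [_ [_]]]]]]; apply. Qed.

Lemma derive1_energy_continuous (x : R) : 0 < x -> {for x, continuous chi'}.
Proof.
by move=> x0; apply: differentiable_continuous; apply/derivable1_diffP;
  exact: chi'_derivable.
Qed.

Lemma derive1_energy_lt (x y : R) : 0 < x -> x < y -> chi' x < chi' y.
Proof.
move=> x0 xy.
have pos z : z \in `[x, y] -> 0 < z.
  by rewrite in_itv/= => /andP[xz _]; exact: lt_le_trans xz.
have [z||c] := @MVT R chi' (derive1 chi') x y xy.
- move=> zxy; rewrite derive1E; apply: derivableP; apply: chi'_derivable.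
  by apply: pos; exact: subset_itv_oo_cc.
- apply: derivable_within_continuous => z /pos; exact: chi'_derivable.
move=> cxy E; rewrite -subr_gt0 E mulr_gt0 ?subr_gt0//.
case: ied => _ [_ [_ [_ [+ _]]]]; apply.
by apply: pos; exact: subset_itv_oo_cc.
Qed.

Lemma derive1_energy_le (x y : R) : 0 < x -> x <= y -> chi' x <= chi' y.
Proof.
move=> x0; rewrite le_eqVlt => /predU1P[->//|xy].
by apply: ltW; exact: derive1_energy_lt.
Qed.

Lemma derive1_energy_ge0 (x : R) : 0 < x -> 0 <= chi' x.
Proof.
move=> x0; case: ied => _ [_ [_ [_ [_ [l0 _]]]]].
apply: (cvgr_to_le l0); near=> y; apply: derive1_energy_le => //.
by near: y; exact: nbhs_right_le.
Unshelve. all: by end_near. Qed.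

Let energy_MVT (x y : R) : 0 <= x -> x < y ->
  exists2 c, x < c < y & chi y - chi x = chi' c * (y - x).
Proof.
move=> x0 xy; have [z||c] := @MVT R chi chi' x y xy.
- rewrite in_itv/= => /andP[xz _]; rewrite derive1E; apply: derivableP.
  by apply: chi_derivable; exact: le_lt_trans xz.
- apply: continuous_subspaceW chi_continuous => z /=.
  by rewrite !in_itv/= andbT => /andP[xz _]; exact: le_trans xz.
by rewrite in_itv/= => cxy E; exists c.
Qed.

Lemma energy_tangent (s z : R) : 0 <= s -> 0 < z ->
  chi z - chi s <= chi' z * (z - s).
Proof.
move=> s0 z0; case: (ltgtP s z) => [sz|zs|->]; last by rewrite !subrr mulr0.
- have [c /andP[sc cz] ->] := energy_MVT s0 sz.
  rewrite ler_wpM2r ?subr_ge0 ?(ltW sz)//.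
  by apply: derive1_energy_le (ltW cz); exact: le_lt_trans sc.
- have [c /andP[zc cs] E] := energy_MVT (ltW z0) zs.
  rewrite -opprB E -[z - s]opprB mulrN lerN2.
  rewrite ler_wpM2r ?subr_ge0 ?(ltW zs)//.
  exact: derive1_energy_le (ltW zc).
Qed.

Lemma energy_le (s t : R) : 0 <= s -> s <= t -> chi s <= chi t.
Proof.
move=> s0; rewrite le_eqVlt => /predU1P[->//|st].
have [c /andP[sc _] E] := energy_MVT s0 st.
rewrite -subr_ge0 E mulr_ge0 ?subr_ge0 ?(ltW st)//.
by apply: derive1_energy_ge0; exact: le_lt_trans sc.
Qed.

Lemma measurable_energy : measurable_fun (`[0, +oo[%classic : set R) chi.
Proof. exact: subspace_continuous_measurable_fun. Qed.

Lemma kappa_le (x y : R) : 0 < x -> x <= y -> kap x <= kap y.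
Proof.
move=> x0 xy.
have int z : 0 < z ->
    mu.-integrable `[Num.min z 1, Num.max z 1] (EFin \o (fun s => d2 chi s / s)).
  by case: ied => _ [_ [_ [_ [_ [_ [+ _]]]]]]; apply.
have ge0 s : 0 < s -> 0 <= d2 chi s / s.
  move=> s0; rewrite divr_ge0 ?(ltW s0)//.
  by apply: ltW; case: ied => _ [_ [_ [_ [+ _]]]]; apply.
have mono (A B : set R) : measurable A -> measurable B -> A `<=` B ->
    mu.-integrable B (EFin \o (fun s => d2 chi s / s)) ->
    (forall s, B s -> 0 < s) ->
    Rintegral mu A (fun s => d2 chi s / s) <= Rintegral mu B (fun s => d2 chi s / s).
  move=> mA mB AB iB B0; rewrite /Rintegral fine_le//.
  - by apply: integrable_fin_num => //; exact: integrableS iB.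
  - exact: integrable_fin_num.
  - apply: ge0_subset_integral => //; first by case/integrableP: iB.
    by move=> s /B0 /ge0; rewrite lee_fin.
rewrite /kappa; have [x1|x1] := leP 1 x.
  rewrite (le_trans x1 xy); apply: mono => //.
  - by apply: subset_itvl; rewrite bnd_simp.
  - have := int y (lt_le_trans x0 xy).
    by rewrite min_r ?max_l// (le_trans x1 xy).
  - by move=> s; rewrite /= in_itv/= => /andP[s1 _]; exact: lt_le_trans s1.
have [y1|y1] := leP 1 y.
  apply: (@le_trans _ _ 0).
    rewrite oppr_le0; apply: Rintegral_ge0 => s; rewrite /= in_itv/= => /andP[xs _].
    by apply: ge0; exact: lt_le_trans xs.
  apply: Rintegral_ge0 => s; rewrite /= in_itv/= => /andP[xs _].
  by apply: ge0; exact: lt_le_trans xs.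
rewrite lerN2; apply: mono => //.
- by apply: subset_itvr; rewrite bnd_simp.
- by have := int x x0; rewrite min_l ?max_r// ltW.
- by move=> s; rewrite /= in_itv/= => /andP[s1 _]; exact: lt_le_trans s1.
Qed.

Let Kfun_diff (x y : R) : 0 <= x -> x <= y -> K y - K x = Rintegral mu `]x, y] kap.
Proof.
move=> x0 xy; rewrite /Kfun Rintegral_itvB// ?bnd_simp//.
by apply: kappa_integrable; exact: le_trans xy.
Qed.

Let kappa_integrable_oc (x y : R) : 0 <= x -> x <= y ->
  mu.-integrable `]x, y] (EFin \o kap).
Proof.
move=> x0 xy; apply: integrableS (kappa_integrable (le_trans x0 xy)) => //.
by apply: subset_itv; rewrite bnd_simp.
Qed.

Let cst_integrable (x y c : R) : mu.-integrable `]x, y] (EFin \o cst c).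
Proof.
apply: measurable_bounded_integrable => //; last exact: bounded_cst.
by rewrite /= lebesgue_measure_itv/=; case: ifP => // _; rewrite -EFinB ltry.
Qed.

Let Rintegral_cst_oc (x y c : R) : x <= y ->
  Rintegral mu `]x, y] (cst c) = c * (y - x).
Proof.
move=> xy; rewrite Rintegral_cst//= lebesgue_measure_itv/= lte_fin.
by move: xy; rewrite le_eqVlt => /predU1P[->|->//]; rewrite ltxx subrr.
Qed.

Lemma Kfun_tangent (x y : R) : 0 <= x -> 0 < y -> K y - K x <= kap y * (y - x).
Proof.
move=> x0 y0; have [xy|/ltW yx] := leP x y.
  rewrite Kfun_diff// -(Rintegral_cst_oc (kap y) xy); apply: le_Rintegral => //.
  - exact: kappa_integrable_oc.
  - exact: cst_integrable.
  - move=> s; rewrite /= in_itv/= => /andP[xs sy].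
    by apply: kappa_le => //; exact: le_lt_trans xs.
rewrite -opprB Kfun_diff ?(ltW y0)// -[y - x]opprB mulrN lerN2.
rewrite -(Rintegral_cst_oc (kap y) yx); apply: le_Rintegral => //.
- exact: cst_integrable.
- by apply: kappa_integrable_oc => //; exact: ltW.
- move=> s; rewrite /= in_itv/= => /andP[xs sy].
  by apply: kappa_le => //; exact: ltW.
Qed.

Let absK (M : R) := Rintegral mu `[0, M] (fun x => `|kap x|).

Let absK_le (x M : R) : 0 <= x -> x <= M -> absK x <= absK M.
Proof.
move=> x0 xM; have M0 := le_trans x0 xM.
have iM := integrable_norm (kappa_integrable M0).
rewrite /absK /Rintegral fine_le//.
- by apply: integrable_fin_num => //; exact/integrable_norm/kappa_integrable.
- exact: integrable_fin_num.
- apply: ge0_subset_integral => //; first by case/integrableP: iM.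
  by apply: subset_itvl; rewrite bnd_simp.
Qed.

Lemma Kfun_bounded (M : R) : exists C, forall x, 0 <= x <= M -> `|K x| <= C.
Proof.
exists (absK M) => x /andP[x0 xM]; apply: le_trans (absK_le x0 xM).
by apply: le_normr_Rintegral => //; exact: kappa_integrable.
Qed.

(* For y < 1 the negative function kappa is nondecreasing, so that
   y |kappa(y)| is at most the integral of |kappa| over [0, y]. *)
Lemma mul_kappa_bounded (M : R) : exists C, 0 <= C /\
  forall y, 0 < y <= M -> `|kap y| * y <= C.
Proof.
have kap1 : kap 1 = 0.
  by rewrite /kappa lexx set_itv1 Rintegral_set1.
exists (absK 1 + `|kap (Num.max 1 M)| * `|M|); split.
  by rewrite addr_ge0// ?mulr_ge0//; apply: Rintegral_ge0.
move=> y /andP[y0 yM]; have [y1|y1] := leP 1 y.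
  rewrite ler_wpDl//; first by apply: Rintegral_ge0.
  have k0 : 0 <= kap y by rewrite -kap1; apply: kappa_le.
  rewrite ler_pM ?(ltW y0)// ?(le_trans yM)// ?ler_norm//.
  rewrite (ger0_norm k0) ger0_norm; first by apply: kappa_le => //; rewrite le_max yM orbT.
  by rewrite -kap1; apply: kappa_le => //; rewrite le_max lexx.
rewrite ler_wpDr ?mulr_ge0//; apply: (@le_trans _ _ (absK y)); last first.
  by apply: absK_le; exact: ltW.
have iy : mu.-integrable `]0, y] (EFin \o (fun x => `|kap x|)).
  by apply: integrable_norm; apply: kappa_integrable_oc => //; exact: ltW.
rewrite /absK -Rintegral_itv_obnd_cbnd//.
rewrite -[X in _ * X]subr0 -(Rintegral_cst_oc `|kap y| (ltW y0)).
apply: le_Rintegral => //; first exact: cst_integrable.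
move=> s; rewrite /= in_itv/= => /andP[s0 sy].
have k0 : kap y <= 0 by rewrite -kap1; apply: kappa_le => //; exact: ltW.
have ks : kap s <= kap y by exact: kappa_le.
by rewrite /= (ler0_norm k0) (ler0_norm (le_trans ks k0)) lerN2.
Qed.

Lemma measurable_Kfun : measurable_fun setT K.
Proof.
pose P (k : R -> R) s := Rintegral mu `[0, s] k.
have mP k : (forall s, 0 <= s -> mu.-integrable `[0, s] (EFin \o k)) ->
    (forall s, 0 <= k s) -> measurable_fun setT (P k).
  move=> ik k0; apply: nondecreasing_measurable => // s t st.
  have [s0|s0] := leP 0 s; last first.
    rewrite /P set_itv_ge ?bnd_simp -?ltNge// Rintegral_set0.
    by apply: Rintegral_ge0.
  have t0 := le_trans s0 st; rewrite /P /Rintegral fine_le//.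
  - by apply: integrable_fin_num => //; exact: ik.
  - by apply: integrable_fin_num => //; exact: ik.
  - apply: ge0_subset_integral => //; first by case/integrableP: (ik _ t0).
    + by move=> x _; rewrite /= lee_fin k0.
    + by apply: subset_itvl; rewrite bnd_simp.
have ip s : 0 <= s -> mu.-integrable `[0, s] (EFin \o kap^\+).
  by move=> s0; apply: integrable_funrpos => //; exact: kappa_integrable.
have im s : 0 <= s -> mu.-integrable `[0, s] (EFin \o kap^\-).
  by move=> s0; apply: integrable_funrneg => //; exact: kappa_integrable.
have -> : K = (P kap^\+ \- P kap^\-)%R.
  apply/funext => s; rewrite /Kfun /P /=.
  have [s0|s0] := leP 0 s; last first.
    by rewrite set_itv_ge ?bnd_simp -?ltNge// !Rintegral_set0 subrr.
  rewrite -RintegralB//; [|exact: ip|exact: im].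
  apply: eq_Rintegral => x _; rewrite -/(kap x) /funrpos /funrneg /=.
  have [k0|/ltW k0] := leP 0 (kap x); first by rewrite max_r ?oppr_le0// subr0.
  by rewrite max_l ?oppr_ge0// sub0r opprK.
by apply: measurable_funB; apply: mP => // s; rewrite ?funrpos_ge0 ?funrneg_ge0.
Qed.

End EnergyDensity.

Section Reaction.
Context {R : realType}.

Lemma derive1_le_mul_expR (s : R -> R) (tau c : R) : 0 <= tau ->
  {within `[0, tau], continuous s} ->
  (forall t, 0 < t < tau -> derivable s t 1 /\ derive1 s t <= c * s t) ->
  s tau <= s 0 * expR (c * tau).
Proof.
move=> tau0 cs ds; pose f t := s t * expR (- c * t).
have dexp (t : R) : is_derive t 1 (fun t => expR (- c * t)) (expR (- c * t) * - c).
  by apply: is_derive_eq; rewrite /GRing.scale/= mulr1.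
have df t : 0 < t < tau ->
    is_derive t 1 f (s t *: (expR (- c * t) * - c) + expR (- c * t) *: derive1 s t).
  move=> /ds[dst _]; apply: is_deriveM => //; first by rewrite derive1E; exact: derivableP.
have := @ler0_derive1_nincr R f 0 tau _ _ _ 0 tau (lexx _) tau0 (lexx _).
have -> : f 0 = s 0 by rewrite /f mulr0 expR0 mulr1.
have -> : f tau = s tau / expR (c * tau) by rewrite /f mulNr expRN.
rewrite ler_pdivrMr ?expR_gt0// => H.
apply: H => [t|t|].
- by rewrite in_itv/= => /df[].
- rewrite in_itv/= => tt; rewrite derive1E (@derive_val _ _ _ _ _ _ _ (df t tt)).
  have -> : s t *: (expR (- c * t) * - c) + expR (- c * t) *: derive1 s t =
    expR (- c * t) * (derive1 s t - c * s t) by rewrite /GRing.scale/=; ring.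
  rewrite mulr_ge0_le0 ?expR_ge0// subr_le0; exact: (ds t tt).2.
- move=> x; apply: (@continuousM R (subspace `[0, tau]) s (fun t => expR (- c * t))).
    exact: cs.
  apply: continuous_subspaceT => z; apply: differentiable_continuous.
  by apply/derivable1_diffP; case: (dexp z).
Qed.

Lemma reaction_growth (F1 F2 G1 G2 : R -> R -> R) :
  bdd_lip F1 -> bdd_lip F2 -> bdd_lip G1 -> bdd_lip G2 ->
  exists C : R, 0 <= C /\ forall tau s0 r0 s1 r1, 0 <= tau ->
    reaction_flow (SigmaF F1 F2 G1 G2) (RF F1 F2 G1 G2) tau s0 r0 s1 r1 ->
    [/\ 0 <= s0, 0 <= s1, 0 <= r1 <= 1, s1 <= s0 * expR (C * tau) &
        s0 <= s1 * expR (C * tau)].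
Proof.
move=> [M1 [L1 [b1 _]]] [M2 [L2 [b2 _]]] [M3 [L3 [b3 _]]] [M4 [L4 [b4 _]]].
have M10 : 0 <= M1 by apply: le_trans (b1 0 0 _ _).
have M20 : 0 <= M2 by apply: le_trans (b2 0 0 _ _).
have M30 : 0 <= M3 by apply: le_trans (b3 0 0 _ _).
have M40 : 0 <= M4 by apply: le_trans (b4 0 0 _ _).
pose C := (M1 + M4) + (M3 + M2).
have C0 : 0 <= C by rewrite !addr_ge0.
have bnd s q : 0 <= s -> 0 <= q <= 1 ->
    - (C * s) <= SigmaF F1 F2 G1 G2 s q <= C * s.
  move=> s0 /andP[q0 q1]; rewrite -ler_norml /SigmaF normrM (ger0_norm s0) mulrC.
  rewrite ler_wpM2r//.
  have q1' : 0 <= 1 - q by rewrite subr_ge0.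
  have p1 : 0 <= q * s by rewrite mulr_ge0.
  have p2 : 0 <= (1 - q) * s by rewrite mulr_ge0.
  have h1 := b1 _ _ p1 p2; have h2 := b2 _ _ p1 p2.
  have h3 := b3 _ _ p1 p2; have h4 := b4 _ _ p1 p2.
  apply: le_trans (ler_normD _ _) _; rewrite !normrM (ger0_norm q0) (ger0_norm q1') lerD//.
    apply: le_trans (ler_wpM2l q0 (ler_normD _ _)) _.
    by rewrite -[leRHS]mul1r ler_pM// ?addr_ge0// lerD.
  apply: le_trans (ler_wpM2l q1' (ler_normD _ _)) _.
  rewrite -[leRHS]mul1r ler_pM// ?addr_ge0// ?lerD//.
  by rewrite lerBlDr lerDl.
exists C; split => // tau s0 r0 s1 r1 tau0
  [s [q [<- [_ [<- [<- [cs [_ [pos ds]]]]]]]]].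
have t0 : 0 <= (0 : R) <= tau by rewrite lexx.
have t1 : 0 <= tau <= tau by rewrite lexx tau0.
have [s00 _] := pos _ t0; have [s10 q10] := pos _ t1.
have bt t : 0 < t < tau -> - (C * s t) <= derive1 s t <= C * s t.
  move=> /[dup] /ds[_ [-> _]] /andP[/ltW t0' /ltW t1'].
  have [] : 0 <= s t /\ 0 <= q t <= 1 by apply: pos; rewrite t0' t1'.
  exact: bnd.
split => //.
  apply: derive1_le_mul_expR => // t tt; split; first by case: (ds t tt).
  by have /andP[] := bt t tt.
have : (\- s) tau <= (\- s) 0 * expR (- C * tau).
  apply: derive1_le_mul_expR => //.
    by move=> x; apply: (@continuousN R R (subspace `[0, tau])); exact: cs.
  move=> t tt; have [dst _] := ds t tt; split.
    exact: derivableN.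
  rewrite derive1E deriveN// -derive1E /=.
  by have /andP[] := bt t tt; rewrite mulrNN lerNl.
rewrite /= !mulNr lerN2 expRN => H.
by rewrite -ler_pdivrMr ?expR_gt0.
Qed.

Lemma Kfun_growth (chi : R -> R) (C M : R) :
  internal_energy_density chi -> 0 <= C -> exists c : R, 0 <= c /\
  forall tau x y, 0 < tau < 1 -> 0 <= x -> 0 <= y <= M ->
    y <= x * expR (C * tau) -> x <= y * expR (C * tau) ->
    Kfun chi y <= Kfun chi x + c * tau.
Proof.
move=> ied C0; have [B [B0 kB]] := mul_kappa_bounded ied M.
exists (B * (C * expR C)); split; first by rewrite !mulr_ge0 ?expR_ge0.
move=> tau x y /andP[t0 t1] x0 /andP[y0 yM] yx xy.
set e := expR (C * tau) in yx xy.
have e1 : 1 <= e by rewrite -expR0 ler_expR mulr_ge0// ltW.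
move: y0; rewrite le_eqVlt => /predU1P[y0|y0].
  move: xy; rewrite -y0 mul0r => xy.
  have -> : x = 0 by apply/eqP; rewrite eq_le xy x0.
  by rewrite lerDl !mulr_ge0 ?expR_ge0// ltW.
have eC : e - 1 <= C * expR C * tau.
  have h : 1 - C * tau <= e^-1 by rewrite -expRN; exact: expR_ge1Dx.
  have h' : e - C * tau * e <= 1.
    have := ler_wpM2r (le_trans ler01 e1) h.
    by rewrite mulVf ?gt_eqF ?(lt_le_trans ltr01 e1)// mulrBl mul1r.
  have : C * tau * e <= C * tau * expR C.
    rewrite ler_wpM2l ?mulr_ge0 ?(ltW t0)// /e ler_expR ler_piMr//; exact: ltW.
  lra.
have dxy : `|y - x| <= y * (e - 1).
  rewrite ler_norml; apply/andP; split; nra.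
rewrite -lerBlDl; apply: le_trans (Kfun_tangent ied x0 y0) _.
apply: le_trans (ler_norm _) _; rewrite normrM.
apply: (@le_trans _ _ (`|kappa chi y| * (y * (e - 1)))); first exact: ler_wpM2l.
rewrite mulrA -[B * _ * tau]mulrA ler_pM ?subr_ge0// ?mulr_ge0// ?(ltW y0)//.
by rewrite kB// y0.
Qed.

Lemma BV_measurable (a b : R) (f : R -> R) : BV a b f ->
  measurable_fun (`]a, b[%classic : set R) f.
Proof.
move=> [M bvM].
have mcd c d : a < c -> d < b -> measurable_fun (`[c, d]%classic : set R) f.
  move=> ac db; have [dc|cd] := ltP d c.
    by rewrite set_itv_ge ?bnd_simp -?ltNge//; exact: measurable_fun_set0.
  have bv : bounded_variation c d f.
    exists M => _ [s [ps /eqP ls] <-].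
    have sin z : z \in c :: s -> c <= z <= d.
      move=> zs; have [i ilt <-] := nthP c zs.
      have srt : sorted <=%R (c :: s) by rewrite /=; apply: sub_path ps => u v /ltW.
      apply/andP; split.
        have := @sorted_leq_nth _ <=%R le_trans lexx c _ srt 0%N i.
        by rewrite !inE => /(_ isT ilt (leq0n _)).
      have lst : (size s < size (c :: s))%N by [].
      have := @sorted_leq_nth _ <=%R le_trans lexx c _ srt i (size s).
      have -> : nth c (c :: s) (size s) = d by rewrite -ls; exact: (nth_last c (c :: s)).
      by rewrite !inE; apply.
    have := bvM (c :: s) ps; rewrite /variation big_mkord /= => /(_ _).
    have -> : \sum_(i < size s) `|f (nth d s i) - f (nth d (c :: s) i)| =
        \sum_(i < size s) `|f s`_i - f (c :: s)`_i|.
      apply: eq_bigr => i _; rewrite (set_nth_default d 0 (ltn_ord i)).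
      by rewrite (@set_nth_default _ (c :: s) d 0 i)//= ltnS ltnW.
    apply; apply/andP; split; first by rewrite ac (le_lt_trans cd db).
    apply/allP => z zs; have /andP[cz zd] : c <= z <= d by apply: sin; rewrite inE zs orbT.
    by rewrite (lt_le_trans ac cz) (le_lt_trans zd db).
  have bvN := (bounded_variationN bv).
  pose p x := Num.max c (Num.min x d).
  have pE x : x \in `[c, d] -> p x = x.
    by rewrite in_itv/= => /andP[cx xd]; rewrite /p min_l// max_r.
  have pin x : p x \in `[c, d].
    by rewrite in_itv/= /p le_max lexx/= ge_max cd ge_min lexx orbT.
  have pmono : nondecreasing_fun p.
    move=> x y xy; rewrite /p ge_max !le_max lexx/=; apply/orP; right.
    by rewrite le_min !ge_min xy lexx orbT.
  have mtv g : bounded_variation c d g ->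
      measurable_fun (`[c, d]%classic : set R) (fine \o neg_tv c g).
    move=> bg; apply: (@eq_measurable_fun _ _ _ _ _ ((fine \o neg_tv c g) \o p)).
      by move=> x; rewrite inE/= => /pE ->.
    apply: nondecreasing_measurable => // x y xy.
    by apply: (fine_neg_tv_nondecreasing bg) => //; exact: pmono.
  apply: (@eq_measurable_fun _ _ _ _ _ ((fine \o pos_tv c f) \- (fine \o neg_tv c f))).
    by move=> x; rewrite inE/= => /(bounded_variation_pos_neg_tvE bv) ->.
  by apply: measurable_funB; apply: mtv.
have -> : `]a, b[%classic =
    \bigcup_n `[a + n.+1%:R^-1, b - n.+1%:R^-1]%classic :> set R.
  apply/seteqP; split => x /=.
    rewrite in_itv/= => /andP[ax xb].
    have e0 : 0 < Num.min (x - a) (b - x) by rewrite lt_min !subr_gt0 ax.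
    have [n] := filter_ex (near_infty_natSinv_lt (PosNum e0)).
    rewrite /= lt_min => /andP[/ltW n1 /ltW n2]; exists n => //=.
    by rewrite in_itv/= addrC -lerBrDr n1 lerBrDr addrC -lerBrDr.
  move=> [n _ /=]; rewrite !in_itv/= => /andP[ax xb].
  have n0 : 0 < n.+1%:R^-1 :> R by rewrite invr_gt0.
  by rewrite (lt_le_trans _ ax) ?ltrDl// (le_lt_trans xb)// ltrBlDr ltrDl.
apply/measurable_fun_bigcup => // n; have n0 : 0 < n.+1%:R^-1 :> R by rewrite invr_gt0.
by apply: mcd; [rewrite ltrDl|rewrite ltrBlDr ltrDl].
Qed.

End Reaction.

Section Plans.
Local Open Scope ereal_scope.

Lemma mix_pushforward d (T : measurableType d) (R : realType)
    (m : {measure set T -> \bar R}) (phi : T -> T) (e : R) :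
  measurable_fun setT phi -> (0 <= e <= 1)%R ->
  exists m' : {measure set T -> \bar R},
    (forall A, m' A = (1 - e)%:E * m A + e%:E * m (phi @^-1` A)) /\
    forall c : T -> \bar R, measurable_fun setT c -> (forall z, 0 <= c z) ->
      \int[m']_z c z = (1 - e)%:E * \int[m]_z c z + e%:E * \int[m]_z c (phi z).
Proof.
move=> mphi /andP[e0 e1].
have e1' : (0 <= 1 - e)%R by rewrite subr_ge0.
pose push : {measure set T -> \bar R} :=
  measure_function_pushforward__canonical__measure_function_Measure m mphi.
exists (measure_add (mscale (NngNum e1') m) (mscale (NngNum e0) push)); split.
  by move=> A; exact: (measure_addE (mscale (NngNum e1') m) (mscale (NngNum e0) push)).
move=> c mc c0; rewrite ge0_integral_measure_add// !ge0_integral_mscale//=.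
by congr (_ + _); rewrite (ge0_integral_pushforward mphi).
Qed.

Lemma partial_marginal d1 d2 (T1 : measurableType d1) (T2 : measurableType d2)
    (R : realType) (m : {measure set (T1 * T2) -> \bar R}) (E : set T1) :
  measurable E ->
  exists nu : {measure set T2 -> \bar R},
    forall B, nu B = m (E `*` B).
Proof.
move=> mE; have mET : measurable (E `*` [set: T2]) by exact: measurableX.
pose nu : {measure set T2 -> \bar R} :=
  measure_function_pushforward__canonical__measure_function_Measure
    (mrestr m mET) (@measurable_snd _ _ T1 T2).
exists nu => B; rewrite /nu /= /pushforward /mrestr; congr (m _).
by apply/seteqP; split => [[x y] [/= By [Ex _]]|[x y] [/= Ex By]].
Qed.

Lemma density_measure d (T : measurableType d) (R : realType)
    (mu : {measure set T -> \bar R}) (D : set T) (p : T -> R) :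
  measurable D -> measurable_fun D p -> (forall x, D x -> (0 <= p x)%R) ->
  exists nu : {measure set T -> \bar R},
    forall B, nu B = \int[mu]_(x in B `&` D) (p x)%:E.
Proof.
move=> mD mp p0.
pose nu (B : set T) := \int[mu]_(x in B `&` D) (p x)%:E.
have nu0 : nu set0 = 0 by rewrite /nu set0I integral_set0.
have nu_ge0 B : 0 <= nu B.
  by apply: integral_ge0 => x [_ Dx]; rewrite lee_fin p0.
have nu_sigma : semi_sigma_additive nu.
  move=> F mF tF mUF; apply: cvg_toP.
    by apply: ereal_nondecreasing_is_cvgn => m n mn; apply: lee_sum_nneg_natr.
  rewrite /nu setI_bigcupl ge0_integral_bigcup//.
  - by move=> k; exact: measurableI.
  - apply/measurable_EFinP; apply: measurable_funS mp => //.
    by move=> x [k _ []].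
  - by move=> x [k _ [_ Dx]]; rewrite lee_fin p0.
  - exact: trivIset_setIr.
pose nuM : {measure set T -> \bar R} :=
  HB.pack nu (isMeasure.Build _ _ _ nu nu0 nu_ge0 nu_sigma).
by exists nuM.
Qed.

Lemma diagonal_measure d (T : measurableType d) (R : realType)
    (nu : {measure set T -> \bar R}) :
  exists m : {measure set (T * T) -> \bar R},
    (forall A, m A = nu ((fun x => (x, x)) @^-1` A)) /\
    forall c : T * T -> \bar R, measurable_fun setT c -> (forall z, 0 <= c z) ->
      (forall x, c (x, x) = 0) -> \int[m]_z c z = 0.
Proof.
have mdiag : measurable_fun setT (fun x : T => (x, x)).
  exact: measurable_fun_pair.
pose m : {measure set (T * T) -> \bar R} :=
  measure_function_pushforward__canonical__measure_function_Measure nu mdiag.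
exists m; split => // c mc c0 cdiag.
rewrite /m ge0_integral_pushforward//.
by apply: integral0_eq => x _; exact: cdiag.
Qed.

(* The canonical measurable structure of [R] and that of [measurableTypeR R]
   have the same measurable sets but different displays. *)
Lemma measure_to_measurableTypeR (R : realType) (m : {measure set R -> \bar R}) :
  exists m' : {measure set (measurableTypeR R) -> \bar R}, forall A, m' A = m A.
Proof.
have s : semi_sigma_additive (m : set (measurableTypeR R) -> \bar R).
  exact: (@measure_semi_sigma_additive _ _ _ m).
pose m' : {measure set (measurableTypeR R) -> \bar R} :=
  HB.pack (m : set (measurableTypeR R) -> \bar R)
    (isMeasure.Build _ (measurableTypeR R) R m (measure0 m) (measure_ge0 m) s).
by exists m'.
Qed.

Lemma measure_of_measurableTypeR (R : realType)
    (m : {measure set (measurableTypeR R) -> \bar R}) :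
  exists m' : {measure set R -> \bar R}, forall A, m' A = m A.
Proof.
have s : semi_sigma_additive (m : set R -> \bar R).
  exact: (@measure_semi_sigma_additive _ _ _ m).
pose m' : {measure set R -> \bar R} :=
  HB.pack (m : set R -> \bar R)
    (isMeasure.Build _ (R : measurableType _) R m (measure0 m) (measure_ge0 m) s).
by exists m'.
Qed.

End Plans.

Section Wasserstein.
Local Open Scope ereal_scope.
Context {R : realType}.
Variables a b : R.
Local Notation mu := (@lebesgue_measure R).
Local Notation D := (`]a, b[%classic : set R).

Let cost (z : R * R) : \bar R := ((z.1 - z.2) ^+ 2)%:E.

Let measurable_cost : measurable_fun setT cost.
Proof.
apply/measurable_EFinP; apply: measurable_funX; apply: measurable_funB.
  exact: measurable_fst.
exact: measurable_snd.
Qed.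

Let cost_ge0 z : 0 <= cost z.
Proof. by rewrite lee_fin sqr_ge0. Qed.

Lemma W2sq_ge0 (f g : R -> R) : 0 <= W2sq a b f g.
Proof.
by apply: le_ereal_inf_tmp => _ [gam _ <-]; apply: integral_ge0 => z _;
  exact: cost_ge0.
Qed.

Lemma W2sq_refl (p : R -> R) : measurable_fun D p ->
  (forall x, D x -> (0 <= p x)%R) -> W2sq a b p p <= 0.
Proof.
move=> mp p0.
have [nu' nu'E] := @density_measure _ (measurableTypeR R) R mu D p (measurable_itv _) mp p0.
have [nu nuE] := measure_of_measurableTypeR nu'.
have [m [mE m0]] := diagonal_measure nu.
apply: ereal_inf_lbound; exists m; last first.
  by apply: m0 => // x; rewrite /= subrr expr0n.
split => A mA; rewrite mE nuE nu'E.
  by congr integral; apply/seteqP; split => [x [[]]|x []].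
by congr integral; apply/seteqP; split => [x [[]]|x []].
Qed.

(* A plan from f to p is modified by moving, with probability e, the mass that
   starts in E to its destination; this cannot increase the cost, and the first
   marginal becomes the convex combination below. *)
Lemma W2sq_relocate (f p h : R -> R) (gam : {measure set (R * R) -> \bar R})
    (E : set R) (e : R) (f' := fun x => ((1 - e) * f x + e * (f x * \1_(~` E) x + h x))%R) :
  (0 <= e <= 1)%R -> measurable E ->
  measurable_fun D f -> (forall x, D x -> (0 <= f x)%R) ->
  measurable_fun D h -> (forall x, D x -> (0 <= h x)%R) ->
  coupling a b f p gam ->
  (forall B : set R, measurable B -> gam (E `*` B) = \int[mu]_(x in B `&` D) (h x)%:E) ->
  W2sq a b f' p <= \int[gam]_z ((z.1 - z.2) ^+ 2)%:E /\
  mass a b f' = mass a b f.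
Proof.
move=> e01 mE mf f0 mh h0 [gam1 gam2] gamE.
have /andP[e0 e1] := e01.
have e1' : (0 <= 1 - e)%R by rewrite subr_ge0.
have mixid (x : \bar R) : 0 <= x -> (1 - e)%:E * x + e%:E * x = x.
  by move=> x0; rewrite -ge0_muleDl ?lee_fin// -EFinD subrK mul1e.
pose phi1 (z : R * R) : R := (z.2 * \1_E z.1 + z.1 * \1_(~` E) z.1)%R.
pose phi (z : R * R) := (phi1 z, z.2).
have mfst : measurable_fun setT (@fst R R) by exact: measurable_fst.
have msnd : measurable_fun setT (@snd R R) by exact: measurable_snd.
have mphi : measurable_fun setT phi.
  apply: measurable_fun_pair => //.
  apply: measurable_funD; apply: measurable_funM => //.
    by apply: (@measurableT_comp _ _ _ _ _ _ (\1_E : R -> R)).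
  apply: (@measurableT_comp _ _ _ _ _ _ (\1_(~` E) : R -> R)) => //.
  by apply: measurable_indic; exact: measurableC.
have phiE z : E z.1 -> phi1 z = z.2.
  move=> Ez; rewrite /phi1 !indicE (mem_set Ez) mulr1.
  by rewrite memNset ?mulr0 ?addr0// => nEz; exact: (nEz Ez).
have phiN z : ~ E z.1 -> phi1 z = z.1.
  by move=> Ez; rewrite /phi1 !indicE memNset// mulr0 add0r mem_set ?mulr1.
have [gam' [gam'E gam'c]] := mix_pushforward gam mphi e01.
have mI A : measurable A -> measurable (A `&` D) by move=> mA; exact: measurableI.
have mfI A : measurable_fun (A `&` D) (fun x => (f x)%:E).
  by apply/measurable_EFinP; apply: measurable_funS mf => // x [].
have mhI A : measurable_fun (A `&` D) (fun x => (h x)%:E).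
  by apply/measurable_EFinP; apply: measurable_funS mh => // x [].
have f0I A x : (A `&` D) x -> 0 <= (f x)%:E by move=> [_ Dx]; rewrite lee_fin f0.
have h0I A x : (A `&` D) x -> 0 <= (h x)%:E by move=> [_ Dx]; rewrite lee_fin h0.
have first A : measurable A ->
    gam' (A `*` setT) = \int[mu]_(x in A `&` D) (f' x)%:E.
  move=> mA; rewrite gam'E.
  have -> : phi @^-1` (A `*` setT) = (E `*` A) `|` ((A `\` E) `*` setT).
    apply/seteqP; split => [z [/= Az _]|z].
      have [Ez|Ez] := pselect (E z.1); first by left; rewrite phiE in Az.
      by right; rewrite phiN in Az.
    move=> [[Ez Az]|[[Az Ez] _]]; split => //=; first by rewrite phiE.
    by rewrite phiN.
  have -> : gam ((E `*` A) `|` ((A `\` E) `*` setT)) =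
      \int[mu]_(x in A `&` D) (h x)%:E + \int[mu]_(x in (A `\` E) `&` D) (f x)%:E.
    rewrite measureU; last 3 first.
    - exact: measurableX.
    - by apply: measurableX => //; exact: measurableD.
    - by apply/seteqP; split => // z [[Ez _] [[_ /(_ Ez)]]].
    by congr (_ + _); [exact: gamE|apply: gam1; exact: measurableD].
  rewrite gam1//.
  have mf1 : measurable_fun (A `&` D) (fun x => (f x * \1_(~` E) x)%:E).
    apply/measurable_EFinP; apply: measurable_funM.
      by apply/measurable_EFinP; exact: mfI.
    apply: (@measurable_funS _ _ _ _ setT) => //.
    by apply: measurable_indic; exact: measurableC.
  have f10 x : (A `&` D) x -> 0 <= (f x * \1_(~` E) x)%:E.
    by move=> [_ Dx]; rewrite lee_fin mulr_ge0// f0.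
  have -> : \int[mu]_(x in (A `\` E) `&` D) (f x)%:E =
      \int[mu]_(x in A `&` D) (f x * \1_(~` E) x)%:E.
    rewrite setDE setIAC integral_mkcondr; apply: eq_integral => x _.
    by rewrite /patch indicE; case: ifPn; rewrite ?mulr1 ?mulr0.
  have msum : measurable_fun (A `&` D) (fun x => (f x * \1_(~` E) x)%:E + (h x)%:E).
    by apply: emeasurable_funD => //; exact: mhI.
  have sum0 x : (A `&` D) x -> 0 <= (f x * \1_(~` E) x)%:E + (h x)%:E.
    by move=> ADx; rewrite adde_ge0// ?f10//; exact: h0I ADx.
  rewrite [RHS](_ : _ = \int[mu]_(x in A `&` D) ((1 - e)%:E * (f x)%:E +
      e%:E * ((f x * \1_(~` E) x)%:E + (h x)%:E))); last by [].
  rewrite ge0_integralD; last 5 first.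
  - exact: mI.
  - by move=> x ADx; rewrite mule_ge0 ?lee_fin//; exact: f0I ADx.
  - by apply: measurable_funeM; exact: mfI.
  - by move=> x ADx; rewrite mule_ge0 ?lee_fin//; exact: sum0.
  - exact: measurable_funeM.
  rewrite ge0_integralZl_EFin//; [|exact: mI|exact: f0I|exact: mfI].
  rewrite ge0_integralZl_EFin//; last exact: mI.
  rewrite ge0_integralD//; [|exact: mI|exact: h0I|exact: mhI].
  by rewrite [X in _ + _ * X]addeC.
have second B : measurable B ->
    gam' (setT `*` B) = \int[mu]_(x in B `&` D) (p x)%:E.
  move=> mB; rewrite gam'E.
  have -> : phi @^-1` (setT `*` B) = setT `*` B by [].
  by rewrite mixid// gam2.
split.
  apply: (@le_trans _ _ (\int[gam']_z cost z)).
    by apply: ereal_inf_lbound; exists gam'.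
  rewrite gam'c// -[leRHS]mixid; last by apply: integral_ge0 => z _; exact: cost_ge0.
  rewrite leeD2l// lee_wpmul2l ?lee_fin//.
  apply: ge0_le_integral => // [|z _]; first exact: measurableT_comp.
  rewrite lee_fin /=; have [Ez|Ez] := pselect (E z.1); last by rewrite phiN.
  by rewrite phiE// subrr expr0n sqr_ge0.
have tot (g : R -> R) (m : {measure set (R * R) -> \bar R}) :
    (forall A, measurable A -> m (A `*` setT) = \int[mu]_(x in A `&` D) (g x)%:E) ->
    mass a b g = m (setT `*` setT).
  by move=> ->//; rewrite setTI.
apply: etrans (tot _ _ first) _; apply: etrans (esym (tot _ _ gam1)).
exact: etrans (second _ measurableT) (esym (gam2 _ measurableT)).
Qed.

End Wasserstein.

Section EnergyGain.
Context {R : realType} {chi : R -> R} (ied : internal_energy_density chi).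
Local Notation chi' := (derive1 chi).

Section Pointwise.
Variables M dl e : R.
Hypotheses (M0 : 0 < M) (dl0 : 0 < dl) (e0 : 0 < e) (e1 : e < 1).
Let lam := chi' (M + e * M).
Let om := lam - chi' (M - e * M).

Lemma energy_gain_low (s h : R) : 0 <= s <= M -> 0 <= h <= M ->
  chi ((1 - e) * s + e * (s + h)) <= chi s + e * (lam * h).
Proof.
move=> /andP[s0 sM] /andP[h0 hM].
set z := (1 - e) * s + _; have zE : z = s + e * h by rewrite /z; ring.
have eh0 : 0 <= e * h by rewrite mulr_ge0// ltW.
have z0 : 0 <= z by rewrite zE addr_ge0.
have [zz|zpos] := eqVneq z 0.
  have -> : s = 0 by move: zz; rewrite zE; lra.
  have -> : h = 0.
    apply/eqP; move: zz; rewrite zE => zz.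
    by rewrite -(mulrI_eq0 _ (mulfI (lt0r_neq0 e0))); apply/eqP; lra.
  by rewrite zz !mulr0 addr0.
have zgt0 : 0 < z by rewrite lt_def zpos.
have := energy_tangent ied s0 zgt0.
have : chi' z * (z - s) <= lam * (z - s).
  rewrite ler_wpM2r//; first by rewrite zE; lra.
  apply: (derive1_energy_le ied) => //; rewrite zE lerD// ler_wpM2l//; exact: ltW.
have -> : z - s = e * h by rewrite zE; ring.
have -> : lam * (e * h) = e * (lam * h) by ring.
lra.
Qed.

Let pos_low : 0 < M - e * M.
Proof. by rewrite subr_gt0 gtr_pMl. Qed.

Let om0 : 0 <= om.
Proof.
rewrite subr_ge0; apply: (derive1_energy_le ied) => //.
by rewrite lerD2l ge0_cp// mulr_ge0// ltW.
Qed.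

Let z_pos (s h : R) : M < s -> 0 <= h -> (1 - e) * s <= (1 - e) * s + e * h.
Proof. by move=> _ h0; rewrite lerDl mulr_ge0// ltW. Qed.

Lemma energy_gain_mid (s h : R) : M < s -> 0 <= h <= M ->
  chi ((1 - e) * s + e * h) <= chi s + e * (lam * (h - s) + om * s).
Proof.
move=> Ms /andP[h0 hM]; set z := (1 - e) * s + _.
have ze : M - e * M <= z.
  apply: le_trans (z_pos Ms h0); rewrite -{1}[M]mul1r -mulrBl.
  by rewrite ler_wpM2l ?subr_ge0 ?(ltW e1)// ltW.
have z0 : 0 < z by exact: lt_le_trans ze.
have s0 : 0 <= s by rewrite (le_trans (ltW M0))// ltW.
have := energy_tangent ied s0 z0.
have -> : z - s = - (e * (s - h)) by rewrite /z; ring.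
have sh : 0 <= e * (s - h) by rewrite mulr_ge0 ?(ltW e0)//; lra.
have cz : chi' (M - e * M) <= chi' z by exact: (derive1_energy_le ied).
have := ler_wpM2r sh cz.
have := mulr_ge0 (ltW e0) (mulr_ge0 om0 h0).
rewrite /om; nra.
Qed.

Let cst := chi' (M + dl) - chi' (M + dl / 2).

Lemma energy_gain_high (s h : R) : e * M <= dl / 2 ->
  M + dl <= (1 - e) * (M + 2 * dl) ->
  M + 2 * dl <= s -> 0 <= h <= M ->
  chi ((1 - e) * s + e * h) <= chi s + e * (lam * (h - s) - 2 * dl * cst).
Proof.
move=> eM eMd Ms /andP[h0 hM]; set z := (1 - e) * s + _.
have Ms' : M < s by apply: lt_le_trans Ms; rewrite ltrDl mulr_gt0.
have ze : M + dl <= z.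
  apply: le_trans (z_pos Ms' h0); apply: le_trans eMd _.
  by rewrite ler_wpM2l ?subr_ge0 ?(ltW e1).
have Md0 : 0 < M + dl by rewrite addr_gt0.
have z0 : 0 < z by exact: lt_le_trans ze.
have s0 : 0 <= s by rewrite (le_trans (ltW M0))// ltW.
have := energy_tangent ied s0 z0.
have -> : z - s = - (e * (s - h)) by rewrite /z; ring.
have sh : 2 * dl <= s - h by lra.
have cz : chi' (M + dl) <= chi' z by exact: (derive1_energy_le ied).
have cl : lam <= chi' (M + dl / 2).
  apply: (derive1_energy_le ied); last by rewrite lerD2l.
  by rewrite addr_gt0// mulr_gt0.
have c0 : 0 <= cst.
  by rewrite subr_ge0; apply: (derive1_energy_le ied); have := M0; have := dl0; lra.
have : e * ((lam + cst) * (s - h)) <= e * (chi' z * (s - h)).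
  rewrite ler_wpM2l ?(ltW e0)// ler_wpM2r//; first by have := dl0; lra.
  by rewrite /cst; lra.
have : e * (cst * (2 * dl)) <= e * (cst * (s - h)).
  by rewrite ler_wpM2l ?(ltW e0)// ler_wpM2l.
lra.
Qed.

End Pointwise.

Lemma energy_gain_parameter (M dl S m : R) : 0 < M -> 0 < dl -> 0 <= S -> 0 < m ->
  exists e : R, [/\ 0 < e, e < 1, e * M <= dl / 2,
    M + dl <= (1 - e) * (M + 2 * dl) &
    (chi' (M + e * M) - chi' (M - e * M)) * S <
      2 * dl * (chi' (M + dl) - chi' (M + dl / 2)) * m].
Proof.
move=> M0 dl0 S0 m0.
set cst := chi' (M + dl) - chi' (M + dl / 2).
have c0 : 0 < cst.
  by rewrite subr_gt0; apply: (derive1_energy_lt ied); lra.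
pose eta := cst * dl * m / (S + 1).
have S1 : 0 < S + 1 by lra.
have eta0 : 0 < eta by rewrite divr_gt0// !mulr_gt0.
have eta2 : 0 < eta / 2 by rewrite divr_gt0.
have := derive1_energy_continuous ied M0.
move=> /cvgrPdist_lt /(_ _ eta2) /nbhs_ballP[r /= r0 Hr].
pose e := Num.min (2^-1) (Num.min (r / (2 * M)) (dl / (2 * (M + 2 * dl)))).
have e0 : 0 < e.
  rewrite !lt_min invr_gt0 ltr0n/=; apply/andP; split; apply: divr_gt0 => //.
    by rewrite mulr_gt0.
  by rewrite mulr_gt0// addr_gt0// mulr_gt0.
have eh : e <= 2^-1 by rewrite ge_min lexx.
have er : e * M <= r / 2.
  have : e <= r / (2 * M) by rewrite !ge_min lexx !orbT.
  by rewrite ler_pdivlMr ?mulr_gt0//; lra.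
have ed : e * (M + 2 * dl) <= dl / 2.
  have : e <= dl / (2 * (M + 2 * dl)) by rewrite !ge_min lexx !orbT.
  rewrite ler_pdivlMr; first by lra.
  by rewrite mulr_gt0//; lra.
have edl : 0 < e * dl by rewrite mulr_gt0.
have eM : 0 < e * M by rewrite mulr_gt0.
exists e; split => //; [lra|lra|lra|].
have h1 : `|chi' M - chi' (M + e * M)| < eta / 2.
  apply: Hr; rewrite /ball /= opprD addrA subrr sub0r normrN gtr0_norm//; lra.
have h2 : `|chi' M - chi' (M - e * M)| < eta / 2.
  apply: Hr; rewrite /ball /= opprB addrC subrK gtr0_norm//; lra.
have : (chi' (M + e * M) - chi' (M - e * M)) * S <= eta * S.
  rewrite ler_wpM2r//; move: h1 h2; rewrite !ltr_norml => /andP[? ?] /andP[? ?]; lra.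
have : eta * S < cst * dl * m.
  rewrite /eta mulrAC ltr_pdivrMr//.
  have : 0 < cst * dl * m by rewrite !mulr_gt0.
  by move=> c; rewrite mulrDr mulr1 ltrDl.
have : 0 < cst * dl * m by rewrite !mulr_gt0.
lra.
Qed.

End EnergyGain.

Section MaximumPrinciple.
Local Open Scope ereal_scope.
Context {R : realType}.
Variables (a b : R).
Local Notation mu := (@lebesgue_measure R).
Local Notation D := (`]a, b[%classic : set R).

Let mD : measurable D. Proof. exact: measurable_itv. Qed.

Lemma lebesgue_measure_oo_lty : mu D < +oo.
Proof.
by rewrite /= lebesgue_measure_itv/=; case: ifP => // _; rewrite -EFinB ltry.
Qed.

Lemma coupling_density (f p : R -> R) (gam : {measure set (R * R) -> \bar R})
    (E : set R) :
  measurable E -> measurable_fun D p -> (forall x, D x -> (0 <= p x)%R) ->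
  \int[mu]_(x in D) (p x)%:E < +oo -> coupling a b f p gam ->
  exists h : R -> R, [/\ measurable_fun D h,
    (forall x, D x -> (0 <= h x <= p x)%R) &
    forall B : set R, measurable B ->
      gam (E `*` B) = \int[mu]_(x in B `&` D) (h x)%:E].
Proof.
move=> mE mp p0 poo [_ gam2].
have [nu nuE] := partial_marginal gam mE.
have [nu' nu'E] := measure_to_measurableTypeR nu.
have nup (B : set R) : measurable B -> nu' B <= \int[mu]_(x in B `&` D) (p x)%:E.
  move=> mB; rewrite nu'E nuE -gam2//; apply: le_measure; rewrite ?inE.
  - exact: measurableX.
  - exact: measurableX.
  - by move=> z [_ Bz].
have [h [mh hp hE]] := @bounded_density _ (measurableTypeR R) R mu nu' D p mD mp p0 poo nup.
by exists h; split => // B mB; rewrite -nuE -nu'E; exact: hE.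
Qed.

Lemma relocated_competitor (f p : R -> R) (E : set R) (e sl : R) :
  (0 <= e <= 1)%R -> (0 < sl)%R -> measurable E ->
  admissible a b (mass a b p) f ->
  measurable_fun D p -> (forall x, D x -> (0 <= p x)%R) -> mass a b p < +oo ->
  W2sq a b f p \is a fin_num ->
  exists h : R -> R, let f' x := ((1 - e) * f x + e * (f x * \1_(~` E) x + h x))%R in
    [/\ measurable_fun D h, (forall x, D x -> (0 <= h x <= p x)%R),
      \int[mu]_(x in D) (h x)%:E = \int[mu]_(x in E `&` D) (f x)%:E,
      admissible a b (mass a b p) f' & W2sq a b f' p <= W2sq a b f p + sl%:E].
Proof.
move=> e01 sl0 mE [f0 [fint fmass]] mp p0 poo Wfin.
have Df x : D x -> (0 <= f x)%R by rewrite /= in_itv/=; exact: f0.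
have mf : measurable_fun D f by apply/measurable_EFinP; case/integrableP: fint.
have [_ [gam gamc <-] gamW] := lb_ereal_inf_adherent sl0 Wfin.
have [h [mh hp hE]] := coupling_density mE mp p0 poo gamc.
have h0 x : D x -> (0 <= h x)%R by move=> /hp/andP[].
have [We me] := W2sq_relocate e01 mE mf Df mh h0 gamc hE.
have /andP[e0 e1] := e01.
exists h => f'; split => //.
- have := hE setT measurableT; rewrite setTI => <-.
  by case: gamc => + _; apply.
- split; [|split].
  + move=> x xab; have Dx : D x by rewrite /= in_itv.
    by rewrite addr_ge0// mulr_ge0 ?subr_ge0// ?addr_ge0 ?mulr_ge0// ?Df ?h0.
  + apply/integrableP; split.
      apply/measurable_EFinP; apply: measurable_funD; apply: measurable_funM => //.
      apply: measurable_funD => //; apply: measurable_funM => //.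
      apply: (@measurable_funS _ _ _ _ setT) => //.
      by apply: measurable_indic; exact: measurableC.
    rewrite (@eq_integral _ _ _ mu D (fun x => (f' x)%:E)); last first.
      move=> x /[!inE] Dx; rewrite gee0_abs// lee_fin.
      by rewrite addr_ge0// mulr_ge0 ?subr_ge0// ?addr_ge0 ?mulr_ge0// ?Df ?h0.
    by have := me; rewrite /mass => ->; rewrite fmass.
  + by rewrite -fmass; exact: me.
- by apply: le_trans We _; exact: ltW.
Qed.

Lemma energy_gtNy (chi s : R -> R) : internal_energy_density chi ->
  measurable_fun D s -> (forall x, D x -> (0 <= s x)%R) ->
  -oo < \int[mu]_(x in D) (chi (s x))%:E /\
  (\int[mu]_(x in D) (chi (s x))%:E < +oo -> mu.-integrable D (EFin \o (chi \o s))).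
Proof.
move=> ied ms s0.
have mchis : measurable_fun D (EFin \o (chi \o s)).
  apply/measurable_EFinP.
  apply: (@measurable_comp _ _ _ _ _ _ (`[0%R, +oo[%classic : set R)) => //.
    by move=> _ [x Dx <-] /=; rewrite in_itv/= andbT s0.
  exact: measurable_energy.
set f := EFin \o (chi \o s) in mchis *.
have neg : \int[mu]_(x in D) f^\- x < +oo.
  apply: (@le_lt_trans _ _ (\int[mu]_(x in D) (`|chi 0|%:E))).
    apply: ge0_le_integral => //; first exact: measurable_funeneg.
    move=> x Dx; rewrite funenegE ge_max; apply/andP; split; last by rewrite lee_fin.
    rewrite /f /= lee_fin lerNl; apply: le_trans (energy_le ied (lexx 0%R) (s0 x Dx)).
    by rewrite -normrN lerNl ler_norm.
  by rewrite integral_cst// lte_mul_pinfty ?lee_fin// lebesgue_measure_oo_lty.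
have neg0 : 0 <= \int[mu]_(x in D) f^\- x by exact: integral_ge0.
have pos0 : 0 <= \int[mu]_(x in D) f^\+ x by exact: integral_ge0.
change (-oo < \int[mu]_(x in D) f x /\
  (\int[mu]_(x in D) f x < +oo -> mu.-integrable D f)).
rewrite integralE.
have absE : \int[mu]_(x in D) `|f x| =
    \int[mu]_(x in D) f^\+ x + \int[mu]_(x in D) f^\- x.
  rewrite -ge0_integralD//; last 2 first.
  - exact: measurable_funepos.
  - exact: measurable_funeneg.
  by apply: eq_integral => x _; rewrite -[RHS]/((f^\+ \+ f^\-) x) -fune_abse.
move: neg neg0 pos0 absE; case: (\int[mu]_(x in D) f^\- x) => [r _ _| |]//.
case: (\int[mu]_(x in D) f^\+ x) => [r'| |]// _ absE; split => //.
  by rewrite -EFinB ltNyr.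
by move=> _; apply/integrableP; split => //; rewrite absE -EFinD ltry.
Qed.

End MaximumPrinciple.

Section JkoMaximumPrinciple.
Local Open Scope ereal_scope.
Context {R : realType}.
Variables (a b : R).
Local Notation mu := (@lebesgue_measure R).
Local Notation D := (`]a, b[%classic : set R).
Local Notation I f := (mu.-integrable D (EFin \o f)).

Let mD : measurable D. Proof. exact: measurable_itv. Qed.

Let iD (f g : R -> R) : I f -> I g -> I (fun x => f x + g x)%R.
Proof. by move=> fi gi; apply: integrableD fi gi. Qed.

Let iB (f g : R -> R) : I f -> I g -> I (fun x => f x - g x)%R.
Proof. by move=> fi gi; apply: integrableB fi gi. Qed.

Let iZ (k : R) (f : R -> R) : I f -> I (fun x => k * f x)%R.
Proof. by move=> fi; apply: integrableZl fi. Qed.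

Let i1 (f : R -> R) (E : set R) : measurable E -> I f ->
  I (fun x => f x * \1_E x)%R.
Proof.
move=> mE fi; have mf : measurable_fun D f.
  by apply/measurable_EFinP; case/integrableP: fi.
apply: le_integrable fi => //.
  by apply/measurable_EFinP; exact: measurable_funM.
move=> x Dx; rewrite /= lee_fin normrM ler_piMr// indicE.
by case: (_ \in _); rewrite ?normr1 ?normr0.
Qed.

Let icst (c : R) : I (fun=> c).
Proof.
apply: measurable_bounded_integrable => //; first exact: lebesgue_measure_oo_lty.
exact: bounded_cst.
Qed.

Lemma jko_finite (chi : R -> R) (tau M : R) (p q rho eta : R -> R) :
  internal_energy_density chi -> (0 < tau)%R ->
  measurable_fun D p -> measurable_fun D q ->
  (forall x, D x -> (0 <= p x)%R) -> (forall x, D x -> (0 <= q x)%R) ->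
  (forall x, D x -> (p x + q x <= M)%R) ->
  measurable_fun D (fun x => rho x + eta x)%R ->
  (forall x, D x -> (0 <= rho x + eta x)%R) ->
  jko_functional a b chi tau p q rho eta <= jko_functional a b chi tau p q p q ->
  [/\ W2sq a b rho p \is a fin_num, W2sq a b eta q \is a fin_num &
      I (fun x => chi (rho x + eta x)%R)].
Proof.
move=> ied tau0 mp mq p0 q0 pqM ms s0 Jle.
have W0 (f : R -> R) : measurable_fun D f -> (forall x, D x -> (0 <= f x)%R) -> W2sq a b f f = 0.
  by move=> mf f0; apply/eqP; rewrite eq_le W2sq_refl//= W2sq_ge0.
have Epq : calE a b chi p q < +oo.
  apply: (@le_lt_trans _ _ (\int[mu]_(x in D) (0%R)%:E + (chi M)%:E * mu D)).
    apply: (@integral_le_shift _ (measurableTypeR R) R mu D set0 (fun=> 0%R)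
      (fun x => chi (p x + q x)%R)) => //.
    - exact: lebesgue_measure_oo_lty.
    - move=> x Dx _; rewrite add0r; apply: (energy_le ied); last exact: pqM.
      by rewrite addr_ge0 ?p0 ?q0.
  rewrite integral0 add0e; have := lebesgue_measure_oo_lty a b.
  by rewrite -ge0_fin_numE// => /fineK <-; rewrite -EFinM ltry.
have JE : jko_functional a b chi tau p q p q = calE a b chi p q.
  by rewrite /jko_functional !W0// adde0 mule0 add0e.
move: Jle; rewrite JE => /le_lt_trans/(_ Epq); rewrite /jko_functional.
have [Egt Eint] := energy_gtNy ied ms s0.
have := W2sq_ge0 a b rho p; have := W2sq_ge0 a b eta q.
have c0 : (0 < (2 * tau)^-1)%R by rewrite invr_gt0 mulr_gt0.
move: Egt Eint; rewrite -/(calE a b chi rho eta).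
case: (calE a b chi rho eta) => [r| |]// _ Eint.
- case: (W2sq a b eta q) => [w2| |]// _; case: (W2sq a b rho p) => [w1| |]// _;
    rewrite ?addye ?addey ?gt0_muley ?addye// => _.
  by split => //; apply: Eint; rewrite ltry.
- case: (W2sq a b eta q) => [w2| |]// _; case: (W2sq a b rho p) => [w1| |]// _;
    rewrite ?addye ?addey ?gt0_muley ?addye ?addey//.
Qed.

Lemma superlevel_gap (s : R -> R) (M : R) : measurable_fun D s ->
  mu (D `&` [set x | M < s x]%R) != 0 ->
  exists dl : R, (0 < dl)%R /\ mu (D `&` [set x | M + 2 * dl <= s x]%R) != 0.
Proof.
move=> ms muE; apply: contrapT => nex.
have En (n : nat) : mu (D `&` [set x | M + 2 * n.+1%:R^-1 <= s x]%R) = 0.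
  apply: contrapT => /eqP ne0; apply: nex; exists (n.+1%:R^-1)%R.
  by split => //; rewrite invr_gt0.
have mE : measurable (D `&` [set x | M < s x]%R).
  by apply: (@measurable_fun_ltr _ _ _ D (cst M) s).
move/negP: muE; apply; apply/eqP; apply: measure_negligible => //.
apply: (@negligibleS _ (measurableTypeR R) R mu (\bigcup_n (D `&` [set x | M + 2 * n.+1%:R^-1 <= s x]%R))).
  move=> x [Dx /= Msx].
  have e0 : (0 < (s x - M) / 2)%R by rewrite divr_gt0// subr_gt0.
  have [n /= nlt] := filter_ex (near_infty_natSinv_lt (PosNum e0)).
  exists n => //; split => //=; move: nlt; rewrite ltr_pdivlMr// => /ltW.
  by rewrite mulrC lerBrDl.
apply: negligible_bigcup => n; exists (D `&` [set x | M + 2 * n.+1%:R^-1 <= s x]%R).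
split => //; first exact: (@measurable_fun_ler _ _ _ D (cst (M + 2 * n.+1%:R^-1)%R) s).
exact: En.
Qed.

Lemma jko_maximum_principle (chi : R -> R) (tau M : R) (p q rho eta : R -> R) :
  internal_energy_density chi -> (0 < tau)%R -> (0 < M)%R ->
  measurable_fun D p -> measurable_fun D q ->
  (forall x, D x -> (0 <= p x)%R) -> (forall x, D x -> (0 <= q x)%R) ->
  (forall x, D x -> (p x + q x <= M)%R) ->
  admissible a b (mass a b p) rho -> admissible a b (mass a b q) eta ->
  (forall f g, admissible a b (mass a b p) f -> admissible a b (mass a b q) g ->
     jko_functional a b chi tau p q rho eta <= jko_functional a b chi tau p q f g) ->
  mu (D `&` [set x | M < rho x + eta x]%R) = 0.
Proof.
move=> ied tau0 M0 mp mq p0 q0 pqM arho aeta minJ.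
have Dab x : D x = (a < x < b)%R by rewrite /= in_itv.
have [rho0 [irho _]] := arho; have [eta0 [ieta _]] := aeta.
pose s x := (rho x + eta x)%R.
have is_ : I s by exact: iD.
have ms : measurable_fun D s by apply/measurable_EFinP; case/integrableP: is_.
have s0 x : D x -> (0 <= s x)%R.
  by rewrite Dab => xab; rewrite addr_ge0 ?rho0 ?eta0.
have ibound (f : R -> R) : measurable_fun D f ->
    (forall x, D x -> (0 <= f x <= M)%R) -> I f.
  move=> mf fM; apply: le_integrable (icst M) => //; first exact/measurable_EFinP.
  move=> x Dx; have /andP[f0 fM'] := fM x Dx.
  by rewrite /= lee_fin !ger0_norm// ltW.
have ip : I p.
  by apply: ibound => // x Dx; rewrite p0//= (le_trans _ (pqM x Dx))// lerDl q0.
have iq : I q.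
  by apply: ibound => // x Dx; rewrite q0//= (le_trans _ (pqM x Dx))// lerDr p0.
have ap : admissible a b (mass a b p) p by split => // x; rewrite -Dab; exact: p0.
have aq : admissible a b (mass a b q) q by split => // x; rewrite -Dab; exact: q0.
have poo : mass a b p < +oo by exact: integrable_lty.
have qoo : mass a b q < +oo by exact: integrable_lty.
have [W1 W2 ichi] := jko_finite ied tau0 mp mq p0 q0 pqM ms s0 (minJ p q ap aq).
apply: contrapT => /eqP muE.
have [dl [dl0 muE2]] := superlevel_gap ms muE.
pose E := D `&` [set x | M < s x]%R.
pose E2 := D `&` [set x | M + 2 * dl <= s x]%R.
have mE : measurable E by exact: (@measurable_fun_ltr _ _ _ D (cst M) s).
have mE2 : measurable E2 by exact: (@measurable_fun_ler _ _ _ D (cst (M + 2 * dl)%R) s).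
have mu2fin : mu E2 \is a fin_num.
  rewrite ge0_fin_numE//; apply: le_lt_trans (lebesgue_measure_oo_lty a b).
  by apply: le_measure; rewrite ?inE//; exact: subIsetl.
pose m2 := fine (mu E2).
have m20 : (0 < m2)%R by rewrite fine_gt0// lt0e muE2 measure_ge0 /= -ge0_fin_numE.
pose S := Rintegral mu D s.
have S0 : (0 <= S)%R by exact: Rintegral_ge0.
have [e [e0 e1 eM eMd egain]] := energy_gain_parameter ied M0 dl0 S0 m20.
set lam := derive1 chi (M + e * M) in egain.
set om := (lam - derive1 chi (M - e * M))%R in egain.
set cs := (derive1 chi (M + dl) - derive1 chi (M + dl / 2))%R in egain.
pose g := (e * (2 * dl * cs * m2 - om * S))%R.
have g0 : (0 < g)%R by rewrite mulr_gt0// subr_gt0.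
have sl0 : (0 < g * tau / 2)%R by rewrite divr_gt0// mulr_gt0.
have e01 : (0 <= e <= 1)%R by rewrite !ltW.
have [h1 [mh1 h1p H1 af We1]] :=
  relocated_competitor e01 sl0 mE arho mp p0 poo W1.
have [h2 [mh2 h2q H2 ag We2]] :=
  relocated_competitor e01 sl0 mE aeta mq q0 qoo W2.
set f' := (fun x : R => _) in af We1; set g' := (fun x : R => _) in ag We2.
pose h x := (h1 x + h2 x)%R.
have ih1 : I h1.
  apply: ibound => // x Dx; have /andP[-> h1x] := h1p x Dx.
  by rewrite (le_trans h1x)// (le_trans _ (pqM x Dx))// lerDl q0.
have ih2 : I h2.
  apply: ibound => // x Dx; have /andP[-> h2x] := h2q x Dx.
  by rewrite (le_trans h2x)// (le_trans _ (pqM x Dx))// lerDr p0.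
have ih : I h by exact: iD.
have hM x : D x -> (0 <= h x <= M)%R.
  move=> Dx; have /andP[h10 h1x] := h1p x Dx; have /andP[h20 h2x] := h2q x Dx.
  by rewrite addr_ge0//= (le_trans _ (pqM x Dx))// lerD.
pose sE x := (s x * \1_E x)%R.
have isE : I sE by exact: i1.
have hs : Rintegral mu D h = Rintegral mu D sE.
  have part (k k' : R -> R) : \int[mu]_(x in D) (k x)%:E = \int[mu]_(x in E `&` D) (k' x)%:E ->
      Rintegral mu D k = Rintegral mu D (fun x => k' x * \1_E x)%R.
    rewrite /Rintegral => ->; rewrite setIC integral_mkcondr; congr fine.
    apply: eq_integral => x _; rewrite /patch indicE.
    by case: ifPn; rewrite ?mulr1 ?mulr0.
  rewrite RintegralD// (part _ _ H1) (part _ _ H2) -RintegralD//; [|exact: i1|exact: i1].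
  by apply: eq_Rintegral => x _; rewrite /sE /s mulrDl.
pose u x := (chi (s x) + e * (lam * (h x - sE x) + (om * s x - 2 * dl * cs * \1_E2 x)))%R.
have iE2 : I (\1_E2 : R -> R).
  apply: eq_integrable (i1 mE2 (icst 1)) => // x _; by rewrite /= mul1r.
have iu : I u.
  apply: iD => //; apply: iZ; apply: iD; first by apply: iZ; exact: iB.
  by apply: iB; exact: iZ.
have Ru : Rintegral mu D u = (Rintegral mu D (chi \o s) - g)%R.
  rewrite /u RintegralD//; last first.
    by apply: iZ; apply: iD; [apply: iZ; exact: iB|apply: iB; exact: iZ].
  rewrite RintegralZl//; last by apply: iD; [apply: iZ; exact: iB|apply: iB; exact: iZ].
  rewrite RintegralD//; [|by apply: iZ; exact: iB|by apply: iB; exact: iZ].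
  rewrite RintegralZl//; last exact: iB.
  rewrite RintegralB// hs subrr mulr0 add0r.
  rewrite RintegralB//; [|exact: iZ|exact: iZ].
  rewrite !RintegralZl//.
  have -> : Rintegral mu D (\1_E2 : R -> R) = m2.
    rewrite /Rintegral integral_indic// setIidl//; exact: subIsetl.
  by rewrite /g -/S; ring.
have Ele : calE a b chi f' g' <= (Rintegral mu D (chi \o s) - g)%:E.
  rewrite -Ru /Rintegral fineK ?integrable_fin_num//.
  apply: le_trans (_ : _ <= \int[mu]_(x in D) (u x)%:E + 0%:E * mu D) _; last first.
    by rewrite mul0e adde0.
  apply: (@integral_le_shift _ (measurableTypeR R) R mu D set0 u
    (fun x => chi (f' x + g' x)%R)) => //; first exact: lebesgue_measure_oo_lty.
  move=> x Dx _; rewrite addr0.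
  have -> : (f' x + g' x = (1 - e) * s x + e * (s x * \1_(~` E) x + h x))%R.
    by rewrite /f' /g' /s /h; ring.
  have hMx := hM x Dx; have sx := s0 x Dx.
  have om0 : (0 <= om)%R.
    rewrite subr_ge0; apply: (derive1_energy_le ied).
      by rewrite subr_gt0 gtr_pMl.
    by rewrite lerD2l ge0_cp// mulr_ge0// ltW.
  rewrite /u /sE !indicE; have [sM|Ms] := leP (s x) M.
    have nE : x \in E = false by apply: memNset => -[_ /=]; rewrite ltNge sM.
    have nE2 : x \in E2 = false.
      apply: memNset => -[_ /=]; rewrite leNgt => /negP; apply.
      by apply: le_lt_trans sM _; rewrite ltrDl mulr_gt0.
    rewrite in_setC nE nE2 /= mulr0 !mulr1 subr0 mulr0 subr0.
    have := @energy_gain_low _ _ ied M e e0 (s x) (h x).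
    rewrite sx sM => /(_ isT hMx); rewrite -/lam => H; apply: le_trans H _.
    by rewrite lerD2l ler_wpM2l ?(ltW e0)// lerDl mulr_ge0.
  have EE : x \in E by rewrite inE.
  rewrite in_setC EE /= mulr0 add0r mulr1.
  have [E2x|nE2x] := boolP (x \in E2); last first.
    rewrite mulr0 subr0.
    exact: (@energy_gain_mid _ _ ied M e M0 e0 e1).
  rewrite mulr1; move: E2x; rewrite inE => -[_ /= E2x].
  have := @energy_gain_high _ _ ied M dl e M0 dl0 e0 e1 (s x) (h x) eM eMd E2x hMx.
  rewrite -/lam -/cs => H; apply: le_trans H _.
  by rewrite lerD2l ler_wpM2l ?(ltW e0)// lerD2l lerDr mulr_ge0.
have := minJ f' g' af ag; apply/negP; rewrite -ltNge /jko_functional.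
have calEE : calE a b chi rho eta = (Rintegral mu D (chi \o s))%:E.
  by rewrite /Rintegral fineK// integrable_fin_num.
rewrite calEE.
have c0 : (0 < (2 * tau)^-1)%R by rewrite invr_gt0 mulr_gt0.
apply: (@le_lt_trans _ _ (((2 * tau)^-1)%:E *
  ((W2sq a b rho p + (g * tau / 2)%:E) + (W2sq a b eta q + (g * tau / 2)%:E)) +
  (Rintegral mu D (chi \o s) - g)%:E)).
  by apply: leeD => //; rewrite lee_wpmul2l ?lee_fin ?(ltW c0)// leeD.
set X := Rintegral _ _ _.
case: (W2sq a b rho p) W1 => [w1| |]// _; case: (W2sq a b eta q) W2 => [w2| |]// _.
rewrite lte_fin.
have -> : ((2 * tau)^-1 * (w1 + g * tau / 2 + (w2 + g * tau / 2)) =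
    (2 * tau)^-1 * (w1 + w2) + g / 2)%R.
  by field; rewrite gt_eqF.
lra.
Qed.

End JkoMaximumPrinciple.

Section SchemeBound.
Local Open Scope ereal_scope.
Context {R : realType}.
Variables (a b : R).
Local Notation mu := (@lebesgue_measure R).
Local Notation D := (`]a, b[%classic : set R).

Let mD : measurable D. Proof. exact: measurable_itv. Qed.

Lemma W2sq_eqr (f g g' : R -> R) :
  (forall B : set R, measurable B ->
    \int[mu]_(x in B `&` D) (g x)%:E = \int[mu]_(x in B `&` D) (g' x)%:E) ->
  W2sq a b f g = W2sq a b f g'.
Proof.
move=> gg'; rewrite /W2sq; congr (ereal_inf (_ @` _)).
apply/seteqP; split => gam [c1 c2]; split => // B mB; rewrite c2//.
  exact: gg'.
exact/esym/gg'.
Qed.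

(* The minimisation problem depends on the data (f1, f2), which are not assumed
   measurable, only through the measurable minorants p and q. *)
Lemma jko_step_bounded (chi : R -> R) (tau M : R) (f1 f2 rho eta : R -> R)
    (N : set R) :
  internal_energy_density chi -> (0 < tau)%R -> (0 < M)%R ->
  measurable N -> mu N = 0 ->
  (forall x, D x -> (0 <= f1 x)%R) -> (forall x, D x -> (0 <= f2 x)%R) ->
  (forall x, D x -> ~ N x -> (f1 x + f2 x <= M)%R) ->
  jko_minimizer a b chi tau f1 f2 rho eta ->
  mu (D `&` [set x | M < rho x + eta x]%R) = 0.
Proof.
move=> ied tau0 M0 mN muN f10 f20 f12M [_ [arho [aeta minJ]]].
have lty (f : R -> R) : (forall x, D x -> (0 <= f x)%R) ->
    (forall x, D x -> ~ N x -> (f x <= M)%R) -> \int[mu]_(x in D) (f x)%:E < +oo.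
  move=> f0 fM; apply: (@le_lt_trans _ _ (\int[mu]_(x in D) (cst M%:E x))).
    apply: (@ge0_le_lower_integral _ (measurableTypeR R) R mu D N) => //.
    by move=> x Dx; rewrite /= lee_fin ltW.
  rewrite integral_cst// lte_mul_pinfty ?lee_fin ?(ltW M0)//.
  exact: lebesgue_measure_oo_lty.
have f1oo : \int[mu]_(x in D) (f1 x)%:E < +oo.
  by apply: lty => // x Dx Nx; rewrite (le_trans _ (f12M x Dx Nx))// lerDl f20.
have f2oo : \int[mu]_(x in D) (f2 x)%:E < +oo.
  by apply: lty => // x Dx Nx; rewrite (le_trans _ (f12M x Dx Nx))// lerDr f10.
have [p [mp p0 pf pN pE]] :=
  @measurable_minorant _ (measurableTypeR R) R mu D N f1 mD mN muN f10 f1oo.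
have [q [mq q0 qf qN qE]] :=
  @measurable_minorant _ (measurableTypeR R) R mu D N f2 mD mN muN f20 f2oo.
have mass1 : mass a b f1 = mass a b p by have := pE setT measurableT; rewrite setTI.
have mass2 : mass a b f2 = mass a b q by have := qE setT measurableT; rewrite setTI.
rewrite mass1 in arho minJ; rewrite mass2 in aeta minJ.
have JE f g : jko_functional a b chi tau f1 f2 f g = jko_functional a b chi tau p q f g.
  by rewrite /jko_functional (W2sq_eqr _ pE) (W2sq_eqr _ qE).
apply: (@jko_maximum_principle _ _ _ chi tau M p q) => //.
- exact: measurable_funTS.
- exact: measurable_funTS.
- move=> x Dx; have [Nx|Nx] := pselect (N x).
    by rewrite pN// qN// addr0 ltW.
  by apply: le_trans (f12M x Dx Nx); rewrite lerD ?pf ?qf.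
- by move=> f g af ag; rewrite -!JE; exact: minJ.
Qed.

Lemma splitting_scheme_bounded (chi : R -> R) (F1 F2 G1 G2 : R -> R -> R)
    (rho0 eta0 r0 : R -> R) (C M tau : R) (Nt : nat)
    (sig r sigh rh rho eta Tm : nat -> R -> R) :
  internal_energy_density chi -> initial_data a b rho0 eta0 r0 ->
  (0 < tau)%R -> (0 <= C)%R -> (0 < M)%R ->
  (forall x, D x -> (rho0 x + eta0 x <= M)%R) ->
  (forall s0 q0 s1 q1,
    reaction_flow (SigmaF F1 F2 G1 G2) (RF F1 F2 G1 G2) tau s0 q0 s1 q1 ->
    [/\ 0 <= s0, 0 <= s1, 0 <= q1 <= 1, s1 <= s0 * expR (C * tau) &
        s0 <= s1 * expR (C * tau)]%R) ->
  splitting_scheme a b chi F1 F2 G1 G2 rho0 eta0 r0 tau Nt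
    sig r sigh rh rho eta Tm ->
  forall n, (n <= Nt)%N -> measurable_fun D (sig n) /\
    exists N : set R, [/\ measurable N, mu N = 0 &
      forall x, D x -> ~ N x -> (sig n x <= M * expR (C * (n%:R * tau)))%R].
Proof.
move=> ied [_ [bv1 [bv2 _]]] tau0 C0 M0 init flow [sch0 sch].
have Dab x : D x -> (a <= x <= b)%R.
  by rewrite /= in_itv/= => /andP[/ltW -> /ltW ->].
elim=> [_|n IH nN].
  split.
    apply: (@eq_measurable_fun _ _ _ _ _ (fun x => rho0 x + eta0 x)%R).
      by move=> x /[!inE] /Dab/sch0[-> _].
    by apply: measurable_funD; exact: BV_measurable.
  exists set0; split => // x Dx _; have [-> _] := sch0 x (Dab x Dx).
  by rewrite mul0r mulr0 expR0 mulr1 init.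
have [_ [N [mN muN sigM]]] := IH (ltnW nN).
have [react [jko [sigE _]]] := sch n nN.
set Mn := (M * expR (C * (n.+1%:R * tau)))%R.
have Mn0 : (0 < Mn)%R by rewrite mulr_gt0// expR_gt0.
have sighM x : D x -> ~ N x -> (sigh n x <= Mn)%R.
  move=> Dx Nx; have [_ _ _ up _] := flow _ _ _ _ (react x (Dab x Dx)).
  apply: le_trans up _; rewrite /Mn -[n.+1]addn1 natrD mulrDl mul1r mulrDr expRD.
  by rewrite mulrA ler_wpM2r ?expR_ge0// sigM.
have [jpos [[_ [irho _]] [[_ [ieta _]] _]]] := jko.
have ms : measurable_fun D (fun x => rho n.+1 x + eta n.+1 x)%R.
  apply: measurable_funD; apply/measurable_EFinP; first by case/integrableP: irho.
  by case/integrableP: ieta.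
split.
  by apply: eq_measurable_fun ms => x /[!inE] /Dab/sigE ->.
exists (D `&` [set x | Mn < rho n.+1 x + eta n.+1 x]%R); split.
- exact: (@measurable_fun_ltr _ _ _ D (cst Mn)).
- apply: (jko_step_bounded ied tau0 Mn0 mN muN _ _ _ jko).
  + move=> x Dx; have [_ s1 /andP[q0 q1] _ _] := flow _ _ _ _ (react x (Dab x Dx)).
    by rewrite mulr_ge0.
  + move=> x Dx; have [_ s1 /andP[q0 q1] _ _] := flow _ _ _ _ (react x (Dab x Dx)).
    by rewrite mulr_ge0// subr_ge0.
  + by move=> x Dx Nx; rewrite -mulrDl addrC subrK mul1r sighM.
- move=> x Dx nlt; rewrite (sigE x (Dab x Dx)) leNgt; apply/negP => lt.
  by apply: nlt.
Qed.

Lemma Kfun_integrable (chi s : R -> R) (B : R) (N : set R) :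
  internal_energy_density chi -> measurable N -> mu N = 0 ->
  measurable_fun D s -> (forall x, D x -> ~ N x -> (0 <= s x <= B)%R) ->
  mu.-integrable D (EFin \o (Kfun chi \o s)).
Proof.
move=> ied mN muN ms sB; have [CK KC] := Kfun_bounded ied B.
have mK : measurable_fun D (EFin \o (Kfun chi \o s)).
  apply/measurable_EFinP; apply: measurableT_comp => //; exact: measurable_Kfun.
apply/integrableP; split => //.
apply: (@le_lt_trans _ _ (\int[mu]_(x in D) (cst `|CK|%:E x))).
  apply: (@ge0_le_lower_integral _ (measurableTypeR R) R mu D N) => //.
    by move=> x Dx; rewrite /= lee_fin.
  move=> x Dx Nx; rewrite /= lee_fin; apply: le_trans (KC _ (sB x Dx Nx)) _; exact: ler_norm.
rewrite integral_cst// lte_mul_pinfty ?lee_fin//.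
exact: lebesgue_measure_oo_lty.
Qed.

End SchemeBound.

Theorem mainTheorem10 (R : realType) (a b T : R) (chi : R -> R)
    (F1 F2 G1 G2 : R -> R -> R) (rho0 eta0 r0 : R -> R) :
  a < b -> 0 < T ->
  internal_energy_density chi ->
  bdd_lip F1 -> bdd_lip F2 -> bdd_lip G1 -> bdd_lip G2 ->
  (forall e : R, 0 <= e -> 0 <= G1 0 e) ->
  (forall p : R, 0 <= p -> 0 <= G2 p 0) ->
  initial_data a b rho0 eta0 r0 ->
  exists c : R, forall (tau : R) (N : nat), 0 < tau < 1 -> N%:R * tau = T ->
    forall sig r sigh rh rho eta Tm : nat -> R -> R,
      splitting_scheme a b chi F1 F2 G1 G2 rho0 eta0 r0 tau N
        sig r sigh rh rho eta Tm ->
      forall n : nat, (n < N)%N ->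
        (calK a b chi (sigh n) <= calK a b chi (sig n) + (c * tau)%:E)%E.
Proof.
move=> ab T0 ied bF1 bF2 bG1 bG2 _ _ data.
have [C [C0 flow]] := reaction_growth bF1 bF2 bG1 bG2.
have [_ [_ [_ [[M1 rhoM] [[M2 etaM] _]]]]] := data.
pose M := `|M1| + `|M2| + 1.
have M0 : 0 < M by rewrite ltr_wpDl// addr_ge0.
have init x : (`]a, b[%classic : set R) x -> rho0 x + eta0 x <= M.
  rewrite /= in_itv/= => xab; rewrite ler_wpDr// lerD//.
    by apply: le_trans (ler_norm _) _; apply: le_trans (rhoM x xab) _; exact: ler_norm.
  by apply: le_trans (ler_norm _) _; apply: le_trans (etaM x xab) _; exact: ler_norm.
pose B := M * expR (C * T).
have [c [c0 Kgrowth]] := Kfun_growth B ied C0.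
exists (c * (b - a)) => tau N /[dup] tau01 /andP[tau0 tau1] NT
  sig r sigh rh rho eta Tm sch n nN.
have flow' s0 q0 s1 q1 := @flow tau s0 q0 s1 q1 (ltW tau0).
have [msig [Z [mZ muZ sigM]]] :=
  splitting_scheme_bounded ied data tau0 C0 M0 init flow' sch (ltnW nN).
have react x : (`]a, b[%classic : set R) x ->
    [/\ 0 <= sig n x, 0 <= sigh n x, sigh n x <= sig n x * expR (C * tau) &
        sig n x <= sigh n x * expR (C * tau)].
  rewrite /= in_itv/= => /andP[/ltW ax /ltW xb].
  have [rx _] := sch.2 n nN.
  by have [] := flow' _ _ _ _ (rx x (introT andP (conj ax xb))).
have sigB x : (`]a, b[%classic : set R) x -> ~ Z x ->
    sig n x * expR (C * tau) <= B.
  move=> Dx Zx; apply: (@le_trans _ _ (M * expR (C * (n%:R * tau)) * expR (C * tau))).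
    by rewrite ler_wpM2r ?expR_ge0// sigM.
  rewrite -mulrA -expRD ler_wpM2l ?(ltW M0)// ler_expR -mulrDr ler_wpM2l//.
  rewrite -NT -[X in _ + X]mul1r -mulrDl ler_wpM2r ?(ltW tau0)//.
  by rewrite natr1 ler_nat.
have iK : (@lebesgue_measure R).-integrable `]a, b[ (EFin \o (Kfun chi \o sig n)).
  apply: (@Kfun_integrable _ a b chi (sig n) B Z) => // x Dx Zx.
  have [s0 _ _ _] := react x Dx; rewrite s0 (le_trans _ (sigB x Dx Zx))//.
  by rewrite ler_peMr// -expR0 ler_expR mulr_ge0// ltW.
have := @integral_le_shift _ (measurableTypeR R) R (@lebesgue_measure R) `]a, b[
  Z (Kfun chi \o sig n) (Kfun chi \o sigh n) (c * tau).
move=> /(_ (measurable_itv _) (lebesgue_measure_oo_lty a b) mZ muZ iK) H.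
have -> : ((c * (b - a) * tau)%:E = (c * tau)%:E * @lebesgue_measure R `]a, b[)%E.
  by rewrite lebesgue_measure_itv/= lte_fin ab -EFinD -EFinM; congr EFin; ring.
apply: H => x Dx Zx; have [s0 s1 up lo] := react x Dx.
by apply: Kgrowth => //; rewrite s1 (le_trans up)// sigB.
Qed.
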